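(* (Bogoliubov's variational principle, convex case.) Let $d\in\mathbb{N}$, $\Omega=\{1,\ldots,d\}^{\mathbb{N}}$, let $A:\Omega\to\mathbb{R}$ be a Hölder potential and let $F:\mathbb{R}\to\mathbb{R}$ be convex (hence continuous). Then the limit $\hat P(F)=\lim_{n\to\infty}\frac1n\log\int e^{nF(A_n(x))}\mu(\mathrm{d}x)$ exists and $$\hat P(F)=\sup_{s\in\mathbb{R}}\left\{-F^*(s)+P(sA)-\log d\right\}=\sup_{\rho\in\mathcal{P}(T)}\left\{F(\rho(A))+h(\rho)\right\}-\log d .$$
   Context: $T:\Omega\to\Omega$ is the shift $T(x_1,x_2,\ldots)=(x_2,x_3,\ldots)$; $\Omega$ carries the metric $d(x,y)=2^{-\min\{n:\,x_n\neq y_n\}}$, and ''Hölder'' refers to this metric. $\mathcal{P}(T)$ is the set of $T$-invariant Borel probabilities on $\Omega$; $h(\rho)$ is the Kolmogorov-Sinai entropy; $\rho(A)=\int A\,\mathrm{d}\rho$. $\mu$ is the maximal entropy probability (product measure with uniform marginals). $A_n=\frac1n(A+A\circ T+\cdots+A\circ T^{n-1})$. The linear pressure is $P(B)=\sup_{\rho\in\mathcal{P}(T)}\{\rho(B)+h(\rho)\}$. $F^*(s)=\sup_{x\in\mathbb{R}}\{sx-F(x)\}\in\mathbb{R}\cup\{\infty\}$ is the Legendre-Fenchel transform. *)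

(* Defs.v *)
From HB Require Import structures.
From mathcomp Require Import all_boot all_order all_algebra.
From mathcomp Require Import all_classical all_reals all_analysis.

Set Implicit Arguments.
Unset Strict Implicit.
Unset Printing Implicit Defensive.

Import Order.TTheory GRing.Theory Num.Theory.
Import numFieldNormedType.Exports.

Local Open Scope classical_set_scope.
Local Open Scope ring_scope.

(* The full shift on d.+1 symbols, so that d : nat ranges over all nonempty
   alphabets. Coordinates are indexed from 0: [x n] is the coordinate x_{n+1}.
   The parameter R only selects the field in which the metric takes values. *)
Definition Omega (R : realType) (d : nat) : Type := nat -> 'I_d.+1.

HB.instance Definition _ (R : realType) (d : nat) :=
  Choice.copy (Omega R d) (nat -> 'I_d.+1).
HB.instance Definition _ (R : realType) (d : nat) :=
  isPointed.Build (Omega R d) (fun=> ord0).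

Section metric.
Context (R : realType) (d : nat).
Implicit Types x y z : Omega R d.

(* 2 ^ (- min {n >= 1 : x_n <> y_n}), and 0 if x = y; the exponent is k.+1
   because the 0-based position k is the 1-based position k.+1. *)
Definition distO x y : R :=
  if pselect (exists k, x k != y k) is left xy then 2^-1 ^+ (ex_minn xy).+1
  else 0.

Lemma distO_le x y n :
  (distO x y <= 2^-1 ^+ n.+1) <-> (forall k, (k < n)%N -> x k = y k).
Proof.
rewrite /distO; case: pselect => [xy|nxy].
  case: ex_minnP => m xym mmin; split.
    move=> le_mn k kn; apply/eqP; apply: contraPT kn => /mmin mk.
    apply/negP; rewrite -leqNgt; apply: leq_trans mk.
    move: le_mn; rewrite ler_iXn2l ?invr_gt0 ?invf_lt1 ?ltr1n//.
  move=> xyn; rewrite ler_iXn2l ?invr_gt0 ?invf_lt1 ?ltr1n// ltnS leqNgt.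
  by apply/negP => /xyn /eqP; apply/negP.
split=> [_ k _|_]; last by rewrite exprn_ge0.
by apply/eqP; apply/negP => /negP xyk; apply: nxy; exists k.
Qed.

Lemma distO_ge0 x y : 0 <= distO x y.
Proof. by rewrite /distO; case: pselect => // xy; rewrite exprn_ge0. Qed.

Lemma distOxx x : distO x x = 0.
Proof.
by rewrite /distO; case: pselect => // xx; exfalso; case: xx => k; rewrite eqxx.
Qed.

Lemma distO_eq0 x y : distO x y = 0 -> x = y.
Proof.
move=> xy0; apply/funext => k.
by apply: (distO_le x y k.+1).1 => //; rewrite xy0 exprn_ge0.
Qed.

Lemma distO_sym x y : distO x y = distO y x.
Proof.
wlog suff: x y / distO x y <= distO y x => [le|].
  by apply/eqP; rewrite eq_le !le.
rewrite {2}/distO; case: pselect => [yx|nyx].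
  case: ex_minnP => m _ mmin; apply/distO_le => k km.
  by apply/eqP; apply: contraLR km; rewrite eq_sym -leqNgt; exact: mmin.
suff -> : x = y by rewrite distOxx.
by apply/funext => k; apply/eqP; apply/negP => /negP xyk; apply: nyx; exists k;
  rewrite eq_sym.
Qed.

Lemma distO_triangle y x z : distO x z <= distO x y + distO y z.
Proof.
have [xy|xy] := pselect (exists k, x k != y k); last first.
  suff -> : x = y by rewrite distOxx add0r.
  apply/funext => k; apply/eqP; apply/negP => /negP xyk; apply: xy.
  by exists k.
have [yz|yz] := pselect (exists k, y k != z k); last first.
  suff -> : y = z by rewrite distOxx addr0.
  apply/funext => k; apply/eqP; apply/negP => /negP yzk; apply: yz.
  by exists k.
have [n dxy] : exists n, distO x y = 2^-1 ^+ n.+1.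
  by rewrite /distO; case: pselect => // e; exists (ex_minn e).
have [m dyz] : exists m, distO y z = 2^-1 ^+ m.+1.
  by rewrite /distO; case: pselect => // e; exists (ex_minn e).
have exy : forall k, (k < n)%N -> x k = y k by apply/distO_le; rewrite dxy.
have eyz : forall k, (k < m)%N -> y k = z k by apply/distO_le; rewrite dyz.
have xz : distO x z <= 2^-1 ^+ (minn n m).+1.
  by apply/distO_le => k; rewrite leq_min => /andP[kn km]; rewrite exy// eyz.
apply: le_trans xz _; rewrite dxy dyz.
by have [_|_] := leqP n m; rewrite ?lerDl ?lerDr exprn_ge0.
Qed.

HB.instance Definition _ := isMetric.Build R (Omega R d)
  distOxx distO_eq0 distO_sym distO_triangle.

End metric.

(* The Borel sigma-algebra of the metric topology. *)
HB.instance Definition _ (R : realType) (d : nat) :=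
  @isMeasurable.Build (sigma_display (@open (Omega R d))) (Omega R d)
    <<s @open (Omega R d) >> (@sigma_algebra0 _ setT _) (@sigma_algebraC _ _)
    (@sigma_algebra_bigcup _ setT _).

Definition shiftO {R : realType} {d : nat} (x : Omega R d) : Omega R d :=
  fun n => x n.+1.

Section thermodynamics.
Context {R : realType} {d : nat}.
Local Notation Omega := (Omega R d).
Local Notation prob := (probability Omega R).

Definition holder (A : Omega -> R) : Prop :=
  exists2 alpha : R, 0 < alpha <= 1 &
  exists C : R, forall x y, `|A x - A y| <= C * (mdist x y `^ alpha).

Definition birkhoff_avg (A : Omega -> R) (n : nat) (x : Omega) : R :=
  n%:R^-1 * \sum_(0 <= i < n) A (iter i shiftO x).

Definition invariant_prob : set prob :=
  [set rho | forall B : set Omega, measurable B -> rho (shiftO @^-1` B) = rho B].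

(* The product measure with uniform marginals, through its values on the
   finite-dimensional rectangles. *)
Definition uniform_product (mu : prob) : Prop :=
  forall (n : nat) (B : 'I_n -> {set 'I_d.+1}),
    mu [set x : Omega | forall i : 'I_n, x i \in B i] =
    (\prod_(i < n) (#|B i|%:R / d.+1%:R))%:E.

Definition mean (rho : prob) (A : Omega -> R) : R := \int[rho]_x A x.

(* A finite measurable partition is encoded by the map xi sending a point to
   the label of its atom (empty atoms are allowed). *)
Definition finite_partition (k : nat) (xi : Omega -> 'I_k) : Prop :=
  forall i : 'I_k, measurable (xi @^-1` [set i]).

(* The atom of the join of the shift^-i (xi), i < n, with itinerary w. *)
Definition join_atom (k : nat) (xi : Omega -> 'I_k) (n : nat)
    (w : n.-tuple 'I_k) : set Omega :=
  [set x : Omega | forall i : 'I_n, xi (iter i shiftO x) = tnth w i].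

(* Shannon entropy of that join; the convention 0 log 0 = 0 is automatic. *)
Definition join_entropy (rho : prob) (k : nat) (xi : Omega -> 'I_k)
    (n : nat) : R :=
  - \sum_(w : n.-tuple 'I_k)
      fine (rho (join_atom xi w)) * ln (fine (rho (join_atom xi w))).

(* The limit exists, by subadditivity, when rho is invariant. *)
Definition partition_entropy (rho : prob) (k : nat) (xi : Omega -> 'I_k) : R :=
  limn (fun n : nat => n%:R^-1 * join_entropy rho xi n).

Definition KS_entropy (rho : prob) : \bar R :=
  ereal_sup [set h | exists (k : nat) (xi : Omega -> 'I_k),
    finite_partition xi /\ h = (partition_entropy rho xi)%:E].

Definition pressure (B : Omega -> R) : \bar R :=
  ereal_sup [set ((mean rho B)%:E + KS_entropy rho)%E | rho in invariant_prob].

Definition legendre_fenchel (F : R -> R) (s : R) : \bar R :=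
  ereal_sup [set (s * x - F x)%:E | x in [set: R]].

(* The sequence whose limit is the nonlinear pressure of F. *)
Definition log_laplace (mu : prob) (A : Omega -> R) (F : R -> R) (n : nat) : R :=
  n%:R^-1 * ln (\int[mu]_x expR (n%:R * F (birkhoff_avg A n x))).

End thermodynamics.

(* Main.v *)
Require Import Defs.
From HB Require Import structures.
From mathcomp Require Import all_boot all_order all_algebra.
From mathcomp Require Import all_classical all_reals all_analysis.
From mathcomp Require Import measurable_realfun.
From mathcomp Require Import ring lra zify.

Set Implicit Arguments.
Unset Strict Implicit.
Unset Printing Implicit Defensive.

Import Order.TTheory GRing.Theory Num.Theory.
Import numFieldNormedType.Exports.

Local Open Scope classical_set_scope.
Local Open Scope ring_scope.

(** Why the theorem holds. Cut the space into the cylinders of words of length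
    n. Since [A] is Hoelder, the Birkhoff average of length n varies by O(1/n)
    on such a cylinder, and a convex function is Lipschitz on bounded
    intervals; hence the integral of exp(n F(A_n)) against the uniform measure
    is, up to a factor bounded in n, (d+1)^(-n) times the partition sum
    Z_n = sum over words u of exp(n F(A_n(u))) (log_laplace_partition_sum).
    What has to be shown is that (log Z_n)/n converges to the supremum over
    invariant rho of F(rho(A)) + h(rho) (variational_limit).

    The supremum is a lower bound (pressure_lower). Let rho be invariant and xi
    a finite partition. Up to a small rho-measure, xi is a function psi of the
    first m letters, because cylinders generate the Borel sets
    (partition_approx). Apply Gibbs' inequality to the joint law of a word u of
    length n + m and of the xi-itinerary w of length n, with weights
    exp(N F(A_N(u))), N = n + m, multiplied by exp(-t) for every place where w
    disagrees with the itinerary predicted by psi (entropy_pressure_ineq). The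
    outcome is
    H_n(xi) + E[N F(A_N)] <= log Z_N + n (log(1 + k exp(-t)) + t delta), and a
    supporting line of F at rho(A) bounds E[F(A_N)] below by F(rho(A)) - O(1/N).
    This compares with all finite partitions at once.

    The supremum is an upper bound (pressure_upper). Sort the words of length n
    into boundedly many bins according to A_n(u); one bin S carries a fixed
    fraction of Z_n (heavy_bin), so Z_n is roughly |S| exp(n F(a)), with a the
    value of A_n on S. It remains to find an invariant measure with mean close
    to a and entropy at least (log |S| - log 2)/n (block_law): send each block
    of n uniform letters to S by a map whose fibres have almost equal sizes,
    and average the image of the uniform measure over n consecutive shifts.
    A window of (b+1)n letters contains b complete independent blocks whatever
    its position, and each of them equals a given word with probability at most
    2/|S|; so a word of that length has measure at most (2/|S|)^b.

    The formula with the Legendre transform follows by exchanging the suprema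
    over s and rho, since a convex function is the supremum of its supporting
    lines (legendre_variational). *)

(** * Gibbs' inequality and Fekete's lemma *)

Section real_lemmas.
Context {R : realType}.

Definition shannon (L : finType) (p : L -> R) : R := - \sum_l p l * ln (p l).

Lemma shannonN (L : finType) (p : L -> R) :
  \sum_l ln (p l) * p l = - shannon p.
Proof. by rewrite /shannon opprK; apply: eq_bigr => l _; rewrite mulrC. Qed.

(** Summing ln x <= x - 1 at x = q l / (p l * Z), where Z is the total mass of
    [q]. Suitable weights [q] give both the subadditivity of entropy and its
    comparison with the partition sum. *)
Lemma gibbs_ineq (L : finType) (p q : L -> R) :
  (forall l, 0 <= p l) -> \sum_l p l = 1 ->
  (forall l, 0 <= q l) -> (forall l, 0 < p l -> 0 < q l) ->
  shannon p + \sum_l p l * ln (q l) <= ln (\sum_l q l).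
Proof.
move=> p0 p1 q0 pq; set Z := \sum_l q l.
have Z0 : 0 < Z.
  rewrite lt_neqAle sumr_ge0 ?andbT; last by move=> l _; exact: q0.
  apply/negP => /eqP Zeq0; suff : \sum_l p l = 0 by rewrite p1 => /eqP; rewrite oner_eq0.
  apply: big1 => l _; apply/eqP/negP => /negP pl.
  have /pq : 0 < p l by rewrite lt_neqAle eq_sym pl p0.
  suff -> : q l = 0 by rewrite ltxx.
  apply/eqP; move: (esym Zeq0) => /eqP; rewrite psumr_eq0; last by move=> *; exact: q0.
  by move/allP => /(_ l); rewrite mem_index_enum => /(_ isT).
have key l : p l * ln (q l) - p l * ln (p l) - p l * ln Z <= q l / Z - p l.
  have [pl|pl] := ltP 0 (p l); last first.
    have -> : p l = 0 by apply/eqP; rewrite eq_le pl p0.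
    by rewrite !mul0r !subr0 divr_ge0// ltW.
  have ql := pq _ pl.
  have -> : q l / Z - p l = p l * (q l / p l / Z - 1).
    by field; rewrite !gt_eqF.
  rewrite -!mulrBr ler_pM2l// -ln_div ?posrE// -ln_div ?posrE ?divr_gt0//.
  have e : 0 < q l / p l / Z by rewrite !divr_gt0.
  have := @le_ln1Dx R (q l / p l / Z - 1).
  by rewrite [1 + _]addrC subrK; apply; lra.
have : \sum_l (p l * ln (q l) - p l * ln (p l) - p l * ln Z)
    <= \sum_l (q l / Z - p l) by apply: ler_sum.
rewrite !sumrB -!mulr_suml p1 mul1r divff ?gt_eqF// subrr => h.
by rewrite /shannon; lra.
Qed.

Lemma shannon_ge0 (L : finType) (p : L -> R) :
  (forall l, 0 <= p l) -> \sum_l p l = 1 -> 0 <= shannon p.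
Proof.
move=> p0 p1; rewrite /shannon oppr_ge0 sumr_le0// => l _.
rewrite mulr_ge0_le0// ln_le0// -p1 (bigD1 l)//= lerDl sumr_ge0//.
Qed.

(** If no outcome has probability above [c], then - ln (p l) >= - ln c for each
    outcome that occurs. *)
Lemma shannon_ge (L : finType) (p : L -> R) (c : R) : 0 < c ->
  (forall l, 0 <= p l) -> \sum_l p l = 1 -> (forall l, p l <= c) ->
  - ln c <= shannon p.
Proof.
move=> c0 p0 p1 pc; rewrite /shannon lerN2 -[leRHS]mul1r -p1 mulr_suml.
apply: ler_sum => l _; have [pl|pl] := ltP 0 (p l).
  by rewrite ler_pM2l// ler_ln ?posrE.
have -> : p l = 0 by apply/eqP; rewrite eq_le pl p0.
by rewrite !mul0r.
Qed.

(** The limit is the infimum of a n / n over n > 0: writing n = q m + r gives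
    a n <= q a m + O(1). The second conclusion, which bounds each [a n] below by
    its asymptotic value, is what the lower bound on the pressure needs. *)
Lemma fekete (a : nat -> R) : (forall n, 0 <= a n) ->
  (forall m n, a (m + n)%N <= a m + a n) ->
  exists2 l : R, (fun n => n%:R^-1 * a n) @ \oo --> l & forall n, n%:R * l <= a n.
Proof.
move=> a0 asub.
pose S := [set n.+1%:R^-1 * a n.+1 | n in [set: nat]].
have S0 : S !=set0 by exists (1%:R^-1 * a 1%N), 0%N.
have Slb : has_lbound S by exists 0 => _ [n _ <-]; rewrite mulr_ge0.
have amul m q : a (q * m)%N <= q%:R * a m + a 0%N.
  elim: q => [|q IH]; first by rewrite mul0n mul0r add0r.
  by rewrite mulSn (le_trans (asub _ _))// -natr1; lra.
have Sinf n : (0 < n)%N -> inf S <= n%:R^-1 * a n.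
  by move=> n0; apply: ge_inf => //; exists n.-1 => //; rewrite prednK.
exists (inf S); last first.
  case=> [|n]; first by rewrite mul0r.
  by rewrite mulrC -ler_pdivlMr ?ltr0n// mulrC Sinf.
apply/cvgrPdist_le => e e0.
have [_ [m _ <-] hm] := inf_adherent (divr_gt0 e0 (ltr0Sn R 1)) (conj S0 Slb).
pose K := a 0%N + \sum_(i < m.+1) a i.
have K0 : 0 <= K by rewrite addr_ge0// sumr_ge0.
near=> n.
have n0 : (0 < n)%N by near: n; exists 1%N.
have Sn := Sinf _ n0.
rewrite distrC ger0_norm ?subr_ge0//.
have n0' : 0 < n%:R :> R by rewrite ltr0n.
have : a n <= (n %/ m.+1)%:R * a m.+1 + K.
  rewrite {1}(divn_eq n m.+1) (le_trans (asub _ _))//.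
  have : a (n %% m.+1)%N <= \sum_(i < m.+1) a i.
    have lt := ltn_pmod n (ltn0Sn m).
    by rewrite (bigD1 (Ordinal lt))//= lerDl sumr_ge0.
  by move=> h; rewrite /K addrA lerD.
have : (n %/ m.+1)%:R * a m.+1 <= n%:R * (m.+1%:R^-1 * a m.+1).
  rewrite mulrA ler_wpM2r// ler_pdivlMr ?ltr0n// -natrM ler_nat.
  exact: leq_trunc_div.
have Kn : K <= n%:R * (e / 2).
  rewrite -ler_pdivrMr ?divr_gt0//.
  by near: n; exact: nbhs_infty_ger.
move=> h1 h2; rewrite lerBlDr mulrC ler_pdivrMr//.
have : n%:R * (m.+1%:R^-1 * a m.+1) <= n%:R * (inf S + e / 2) by rewrite ler_pM2l// ltW.
move: h1 h2 Kn; move: (_^-1 * a m.+1) (_ * a m.+1) => u v h1 h2 Kn h3.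
by lra.
Unshelve. all: by end_near. Qed.

End real_lemmas.

(** * Convex functions on the line *)

Section convex.
Context {R : realType} (F : R -> R).
Hypothesis cF : @convex_function R R^o [set: R] F.

Lemma convex_three_points x y z : x < y -> y < z ->
  (z - x) * F y <= (z - y) * F x + (y - x) * F z.
Proof.
move=> xy yz; have xz : 0 < z - x by lra.
have t0 : 0 <= (z - y) / (z - x) by rewrite divr_ge0//; lra.
have t1 : (z - y) / (z - x) <= 1 by rewrite ler_pdivrMr//; lra.
set t := (z - y) / (z - x) in t0 t1 *.
have xD u : u \in ([set: R] : set R) by rewrite inE.
have : F (t * x + (1 - t) * z) <= t * F x + (1 - t) * F z.
  exact: (@cF (Itv01 t0 t1) x z (xD x) (xD z)).
have -> : t * x + (1 - t) * z = y by rewrite /t; field; rewrite gt_eqF.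
have -> : t * F x + (1 - t) * F z = ((z - y) * F x + (y - x) * F z) / (z - x).
  by rewrite /t; field; rewrite gt_eqF.
by rewrite ler_pdivlMr// mulrC.
Qed.

(** The slope is the supremum of the slopes of chords ending at [a]; by
    convexity these lie below all slopes of chords starting at [a]. *)
Lemma convex_support a : exists s, forall x, F a + s * (x - a) <= F x.
Proof.
pose S := [set (F a - F y) / (a - y) | y in [set y | y < a]].
have slopes y z : y < a -> a < z -> (F a - F y) / (a - y) <= (F z - F a) / (z - a).
  move=> ya az; rewrite ler_pdivrMr ?subr_gt0// mulrAC ler_pdivlMr ?subr_gt0//.
  by have := convex_three_points ya az; lra.
have ubz z : a < z -> ubound S ((F z - F a) / (z - a)).
  by move=> az _ [y /= ya <-]; exact: slopes.
have hS : has_sup S.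
  split; first by exists ((F a - F (a - 1)) / (a - (a - 1))), (a - 1) => //=; lra.
  by exists ((F (a + 1) - F a) / (a + 1 - a)); apply: ubz; lra.
exists (sup S) => x; have [xa|ax|->] := ltgtP x a; last by lra.
  have : (F a - F x) / (a - x) <= sup S by apply: ub_le_sup; [exact: hS.2|exists x].
  by rewrite ler_pdivrMr ?subr_gt0//; lra.
have : sup S <= (F x - F a) / (x - a) by apply: ge_sup; [exact: hS.1|exact: ubz].
by rewrite ler_pdivlMr ?subr_gt0//; lra.
Qed.

(** The slopes of supporting lines are nondecreasing, so on [-M, M] they lie
    between those at -(M + 1) and at M + 1. *)
Lemma convex_lipschitz M : exists2 K, 0 <= K & forall x y,
  `|x| <= M -> `|y| <= M -> `|F x - F y| <= K * `|x - y|.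
Proof.
have [s1 hs1] := convex_support (M + 1).
have [s2 hs2] := convex_support (- (M + 1)).
exists (`|s1| + `|s2|) => // x y.
wlog xy : x y / x <= y.
  move=> h xM yM; have [|/ltW] := leP x y; first by move=> ?; exact: h.
  by move=> yx; rewrite distrC [`|x - y|]distrC; exact: h.
rewrite !ler_norml => /andP[xM1 xM2] /andP[yM1 yM2].
have [t1 ht1] := convex_support x; have [t2 ht2] := convex_support y.
have A1 : t2 <= s1.
  rewrite -(@ler_pM2r _ (M + 1 - y)); last by lra.
  by have := ht2 (M + 1); have := hs1 y; lra.
have A2 : s2 <= t1.
  rewrite -(@ler_pM2r _ (x + (M + 1))); last by lra.
  by have := ht1 (- (M + 1)); have := hs2 x; lra.
rewrite [`|x - y|]distrC (ger0_norm (_ : 0 <= y - x)) ?subr_ge0//.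
have B1 : t2 * (y - x) <= (`|s1| + `|s2|) * (y - x).
  rewrite ler_wpM2r ?subr_ge0//; have := ler_norm s1; have := normr_ge0 s2; lra.
have B2 : - (`|s1| + `|s2|) * (y - x) <= t1 * (y - x).
  rewrite ler_wpM2r ?subr_ge0//; have := ler_norm (- s2).
  by rewrite normrN; have := normr_ge0 s1; lra.
by have := ht1 y; have := ht2 x; lra.
Qed.

End convex.

(** * Cylinder sets of the shift space *)

Section cylinders.
Context {R : realType} {d : nat}.
Local Notation Omega := (Omega R d).
Local Notation prob := (probability Omega R).
Local Notation sym := 'I_d.+1.

Definition agree (m : nat) (x y : Omega) : Prop :=
  forall k, (k < m)%N -> x k = y k.

(** The sets that are unions of cylinders of length [m], phrased without
    reference to words; this form is visibly monotone in [m] and stable under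
    set operations. *)
Definition depends (m : nat) (B : set Omega) : Prop :=
  forall x y, agree m x y -> B x -> B y.

Definition cylinder : set (set Omega) := [set B | exists m, depends m B].

Definition word (m : nat) (x : Omega) : m.-tuple sym :=
  [tuple x (val i) | i < m].

(** A point of the cylinder of [u]: the word followed by the letter 0. *)
Definition pad (m : nat) (u : m.-tuple sym) : Omega := fun i => nth ord0 u i.

Lemma agree_sym m x y : agree m x y -> agree m y x.
Proof. by move=> xy k km; symmetry; exact: xy. Qed.

Lemma agreeW m m' x y : (m <= m')%N -> agree m' x y -> agree m x y.
Proof. by move=> mm' xy k km; apply: xy; exact: leq_trans mm'. Qed.

Lemma dependsW m m' B : (m <= m')%N -> depends m B -> depends m' B.
Proof. by move=> mm' dB x y /(agreeW mm'); exact: dB. Qed.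

Lemma word_agree m x y : word m x = word m y <-> agree m x y.
Proof.
split=> [/(congr1 (@tnth _ _)) + k km|xy].
  by move=> /(congr1 (@^~ (Ordinal km))); rewrite !tnth_mktuple.
by apply: eq_from_tnth => i; rewrite !tnth_mktuple; exact: xy (ltn_ord i).
Qed.

Lemma padK m (u : m.-tuple sym) : word m (pad u) = u.
Proof. by apply: eq_from_tnth => i; rewrite tnth_mktuple /pad (tnth_nth ord0). Qed.

Lemma pad_agree m x : agree m (pad (word m x)) x.
Proof. by apply/word_agree; rewrite padK. Qed.

Lemma open_word m (u : m.-tuple sym) : open (word m @^-1` [set u]).
Proof.
rewrite openE => x /= xu; rewrite /interior nbhs_ballP.
exists (2^-1 ^+ m.+1) => /=; first by rewrite exprn_gt0.
move=> y /=; rewrite ballEmdist/= => xy; rewrite -xu; apply/word_agree/agree_sym.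
exact: (distO_le x y m).1 (ltW xy).
Qed.

Lemma depends_measurable m B : depends m B -> measurable B.
Proof.
move=> dB; have -> : B = \bigcup_(u in word m @` B) (word m @^-1` [set u]).
  apply/seteqP; split=> [x Bx|x [_ [y By <-] /= /esym/word_agree xy]].
    by exists (word m x) => //; exists x.
  exact: dB xy By.
apply: fin_bigcup_measurable => // u _.
by apply: sub_sigma_algebra; exact: open_word.
Qed.

(** The largest union of cylinders of length [m] contained in [B]. *)
Definition cyl_interior (m : nat) (B : set Omega) : set Omega :=
  [set x | forall y, agree m x y -> B y].

Lemma depends_cyl_interior m (B : set Omega) : depends m (cyl_interior m B).
Proof. by move=> x y xy Bx z yz; apply: Bx => k km; rewrite (xy _ km); exact: yz. Qed.

Lemma bigcup_cyl_interior B : (forall x, B x -> exists m, cyl_interior m B x) ->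
  B = \bigcup_m cyl_interior m B.
Proof.
move=> hB; apply/seteqP; split=> [x /hB[m xm]|x [m _]]; first by exists m.
by apply.
Qed.

(** Every ball around a point contains a cylinder of that point. *)
Lemma open_cyl_interior B : open B -> B = \bigcup_m cyl_interior m B.
Proof.
rewrite openE => oB; apply: bigcup_cyl_interior => x /oB.
rewrite /interior nbhs_ballP => -[e /= e0 xB].
have [m hm] : exists m, (2^-1 : R) ^+ m.+1 < e.
  have /cvgrPdist_lt /(_ _ e0) [m _ /(_ m.+1)] :
    (fun n => (2^-1 : R) ^+ n) @ \oo --> (0 : R).
    by apply: cvg_expr; rewrite gtr0_norm// invf_lt1// ltr1n.
  rewrite /= sub0r normrN ger0_norm ?exprn_ge0// => h; exists m; exact: h.
exists m => y xy; apply: xB; rewrite ballEmdist/=.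
by apply: le_lt_trans hm; exact: (distO_le x y m).2.
Qed.

Lemma cylinder_setI : setI_closed cylinder.
Proof.
move=> B C [m dB] [m' dC]; exists (maxn m m') => x y xy [Bx Cx].
split; [apply: (dB x)|apply: (dC x)] => //; apply: agreeW xy.
  exact: leq_maxl.
exact: leq_maxr.
Qed.

Lemma cylinder_setU B C : cylinder B -> cylinder C -> cylinder (B `|` C).
Proof.
move=> [m dB] [m' dC]; exists (maxn m m') => x y xy [Bx|Cx].
  by left; apply: (dB x) => //; apply: agreeW xy; exact: leq_maxl.
by right; apply: (dC x) => //; apply: agreeW xy; exact: leq_maxr.
Qed.

Lemma cylinder_setC B : cylinder B -> cylinder (~` B).
Proof.
by move=> [m dB]; exists m => x y xy nBx By; apply/nBx/(dB y) => //; exact: agree_sym.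
Qed.

Lemma cylinder_measurable B : cylinder B -> measurable B.
Proof. by move=> [m /depends_measurable]. Qed.

Lemma measurable_cylinder : measurable = <<s cylinder>>.
Proof.
apply/seteqP; split; last first.
  apply: smallest_sub; first exact: sigma_algebra_measurable.
  by move=> B; exact: cylinder_measurable.
apply: smallest_sub; first exact: smallest_sigma_algebra.
move=> B /open_cyl_interior ->; apply: sigma_algebra_bigcup => m.
by apply: sub_sigma_algebra; exists m; exact: depends_cyl_interior.
Qed.

Lemma prob_unique (P Q : prob) : (forall B, cylinder B -> P B = Q B) ->
  forall B, measurable B -> P B = Q B.
Proof.
move=> PQ B mB; apply: (measure_unique cylinder (fun=> setT)) => //.
- exact: measurable_cylinder.
- exact: cylinder_setI.
- by move=> _; exists 0%N.
- exact: bigcup_const.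
- by move=> k /=; rewrite probability_setT ltry.
Qed.

(** Uniform continuity on the shift space in terms of coordinates. *)
Definition local_map (phi : Omega -> Omega) : Prop :=
  forall m, exists m', forall x y, agree m' x y -> agree m (phi x) (phi y).

Lemma local_cylinder phi B : local_map phi -> cylinder B -> cylinder (phi @^-1` B).
Proof.
by move=> lphi [m dB]; have [m' h] := lphi m; exists m' => x y /h /dB; exact.
Qed.

Lemma local_measurable phi : local_map phi -> measurable_fun setT phi.
Proof.
move=> lphi; apply: (measurability _ measurable_cylinder) => _ [B cB <-].
by rewrite setTI; apply: cylinder_measurable; exact: local_cylinder.
Qed.

Definition unif_cont (f : Omega -> R) : Prop :=
  forall e, 0 < e -> exists m, forall x y, agree m x y -> `|f x - f y| < e.

Lemma unif_cont_measurable f : unif_cont f -> measurable_fun setT f.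
Proof.
move=> uf; apply: (measurability _ (RGenOpens.measurableE R)).
move=> _ [_ [a [b ->] <-]]; rewrite setTI.
rewrite (@bigcup_cyl_interior (f @^-1` _)); last first.
  move=> x /=; rewrite in_itv/= => /andP[ax xb].
  have [|m hm] := uf (Num.min (f x - a) (b - f x)).
    by rewrite lt_min !subr_gt0 ax.
  exists m => y /hm; rewrite lt_min => /andP[/ltr_normlP[h1 h2] /ltr_normlP[h3 h4]].
  by rewrite /= in_itv/=; apply/andP; split; lra.
by apply: bigcupT_measurable => m; exact: (depends_measurable (@depends_cyl_interior m _)).
Qed.

End cylinders.

(** * Approximation of Borel sets by cylinders *)

Section approximation.
Context {R : realType} {d : nat} (rho : probability (Omega R d) R).
Local Notation Omega := (Omega R d).
Local Open Scope ereal_scope.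

(** Such sets form a sigma-algebra containing the cylinders, hence are all the
    Borel sets. *)
Definition approximable (B : set Omega) : Prop := measurable B /\
  forall e : R, (0 < e)%R -> exists2 C, cylinder C & rho (B `+` C) <= e%:E.

Lemma measurable_setY (B C : set Omega) :
  measurable B -> measurable C -> measurable (B `+` C).
Proof. by move=> mB mC; apply: measurableU; exact: measurableD. Qed.

Lemma rho_setY_triangle (B C D : set Omega) :
  measurable B -> measurable C -> measurable D ->
  rho (B `+` D) <= rho (B `+` C) + rho (C `+` D).
Proof.
move=> mB mC mD; have mBC := measurable_setY mB mC.
have mCD := measurable_setY mC mD; have mBD := measurable_setY mB mD.
apply: le_trans (measureU2 _ _ _) => //.
apply: le_measure; rewrite ?inE//; first exact: measurableU.
move=> x; rewrite !setY_def /=; have := EM (C x); tauto.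
Qed.

Lemma approximable_dense B : measurable B ->
  (forall e : R, (0 < e)%R -> exists2 C, approximable C & rho (B `+` C) <= e%:E) ->
  approximable B.
Proof.
move=> mB h; split=> // e e0; have e20 : (0 < e / 2)%R by rewrite divr_gt0.
have [C [mC hC] BC] := h _ e20; have [D cD CD] := hC _ e20.
exists D => //; apply: (le_trans (rho_setY_triangle mB mC (cylinder_measurable cD))).
by rewrite [e in leRHS]splitr EFinD leeD.
Qed.

Lemma cylinder_approximable B : cylinder B -> approximable B.
Proof.
move=> cB; split; first exact: cylinder_measurable.
by move=> e e0; exists B => //; rewrite setYK measure0 lee_fin ltW.
Qed.

Lemma approximable_setU B C : approximable B -> approximable C ->
  approximable (B `|` C).
Proof.
move=> [mB hB] [mC hC]; split; first exact: measurableU.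
move=> e e0; have e20 : (0 < e / 2)%R by rewrite divr_gt0.
have [B' cB' BB'] := hB _ e20; have [C' cC' CC'] := hC _ e20.
exists (B' `|` C'); first exact: cylinder_setU.
have mB' := cylinder_measurable cB'; have mC' := cylinder_measurable cC'.
rewrite [e]splitr EFinD; apply: (le_trans _ (leeD BB' CC')).
have mBB' := measurable_setY mB mB'; have mCC' := measurable_setY mC mC'.
apply: le_trans (measureU2 _ _ _) => //; apply: le_measure; rewrite ?inE//.
- by apply: measurable_setY; exact: measurableU.
- exact: measurableU.
- by move=> x; rewrite !setY_def /=; tauto.
Qed.

Lemma approximable_setC B : approximable B -> approximable (~` B).
Proof.
move=> [mB hB]; split; first exact: measurableC.
move=> e /hB[C cC BC]; exists (~` C); first exact: cylinder_setC.
apply: le_trans BC; rewrite (_ : ~` B `+` ~` C = B `+` C)//.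
by apply/seteqP; split=> x; rewrite !setY_def /=; have := EM (B x);
  have := EM (C x); tauto.
Qed.

(** By continuity from below, the union is close in measure to one of the
    sets. *)
Lemma approximable_nondecreasing (C : (set Omega)^nat) :
  (forall n, approximable (C n)) -> nondecreasing_seq C ->
  approximable (\bigcup_n C n).
Proof.
move=> aC ndC; have mC n : measurable (C n) by have [] := aC n.
have mU : measurable (\bigcup_n C n) by exact: bigcupT_measurable.
apply: approximable_dense => // e e0.
have : rho \o C @ \oo --> (fine (rho (\bigcup_n C n)))%:E.
  by rewrite fineK ?fin_num_measure//; exact: nondecreasing_cvg_mu.
move=> /fine_cvgP[_ /cvgrPdist_le /(_ _ e0)[n _ /(_ n (leqnn n))]] /= hn.
exists (C n) => //.
have CU : C n `<=` \bigcup_n C n by exact: bigcup_sup.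
rewrite setY_def [C n `\` _](_ : _ = set0) ?setU0; last by rewrite setD_eq0.
rewrite measureD//; last by rewrite ltey_eq fin_num_measure.
rewrite setIidr// -(fineK (fin_num_measure rho _ mU)).
rewrite -[X in _ - X](fineK (fin_num_measure rho _ (mC n))) -EFinB lee_fin.
by rewrite (le_trans (ler_norm _)).
Qed.

Lemma measurable_approximable B : measurable B -> approximable B.
Proof.
move: B; rewrite measurable_cylinder; apply: smallest_sub; last first.
  exact: cylinder_approximable.
split=> [|B aB|C aC].
- by apply: cylinder_approximable; exists 0%N.
- by rewrite setTD; exact: approximable_setC.
- rewrite -bigcup_bigsetU_bigcup; apply: approximable_nondecreasing.
    elim=> [|n IH]; first by rewrite big_ord1.
    by rewrite big_ord_recr; exact: approximable_setU.
  by move=> m n mn; apply/subsetPset/subset_bigsetU; rewrite ltnS.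
Qed.

End approximation.

(** * Finite-valued observables and their laws *)

Section observables.
Context {R : realType} {d : nat}.
Local Notation Omega := (Omega R d).
Local Notation prob := (probability Omega R).
Implicit Types (L K : finType) (rho : prob).

(** Measurability for maps into a finite type, without equipping that type
    with a sigma-algebra. *)
Definition observable L (f : Omega -> L) : Prop :=
  forall l, measurable (f @^-1` [set l]).

Lemma observable_preimage L (f : Omega -> L) (E : set L) :
  observable f -> measurable (f @^-1` E).
Proof.
move=> mf; have -> : f @^-1` E = \bigcup_(l in E) (f @^-1` [set l]).
  by apply/seteqP; split=> [x Ex|x [l El /= ->]]; first by exists (f x).
by apply: fin_bigcup_measurable => // l _; exact: mf.
Qed.

Lemma observable_comp L K (g : L -> K) (f : Omega -> L) :
  observable f -> observable (g \o f).
Proof. by move=> mf k; exact: (@observable_preimage _ f (g @^-1` [set k])). Qed.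

Lemma observable_map L (f : Omega -> L) (phi : Omega -> Omega) :
  measurable_fun setT phi -> observable f -> observable (f \o phi).
Proof.
by move=> mphi mf l; rewrite comp_preimage -[X in measurable X]setTI; exact: mphi.
Qed.

Lemma observable_pair L K (f : Omega -> L) (g : Omega -> K) :
  observable f -> observable g -> observable (fun x => (f x, g x)).
Proof.
move=> mf mg [l k]; rewrite (_ : _ @^-1` _ = f @^-1` [set l] `&` g @^-1` [set k]).
  exact: measurableI.
by apply/seteqP; split=> [x [<- <-]//|x [<- <-]].
Qed.

Lemma observable_tuple L n (f : 'I_n -> Omega -> L) :
  (forall i, observable (f i)) -> observable (fun x => [tuple f i x | i < n]).
Proof.
move=> mf w; rewrite (_ : _ @^-1` _ = \bigcap_(i in [set: 'I_n]) (f i @^-1` [set tnth w i])).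
  by apply: fin_bigcap_measurable => // i _; exact: mf.
apply/seteqP; split=> [x <- i _ /=|x xw /=]; first by rewrite tnth_mktuple.
by apply: eq_from_tnth => i; rewrite tnth_mktuple; exact: xw.
Qed.

Lemma observable_local L (f : Omega -> L) m :
  (forall x y, agree m x y -> f x = f y) -> observable f.
Proof.
by move=> fl l; apply: (@depends_measurable _ _ m) => x y /fl /= ->.
Qed.

Lemma observable_word n : observable (@word R d n).
Proof. by apply: (@observable_local _ _ n) => x y /word_agree. Qed.

Lemma bounded_integrable rho (f : Omega -> R) M :
  measurable_fun setT f -> (forall x, `|f x| <= M) ->
  rho.-integrable setT (EFin \o f).
Proof.
move=> mf fM; apply: measurable_bounded_integrable => //.
  by rewrite /= probability_setT ltry.
exists M; split; first exact: num_real.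
by move=> B MB x _ /=; exact: le_trans (fM x) (ltW MB).
Qed.

Definition pr rho L (f : Omega -> L) (l : L) : R := fine (rho (f @^-1` [set l])).

Lemma pr_ge0 rho L (f : Omega -> L) l : 0 <= pr rho f l.
Proof. by rewrite fine_ge0. Qed.

Lemma Rintegral_obs rho L (f : Omega -> L) (phi : L -> R) : observable f ->
  \int[rho]_x phi (f x) = \sum_l phi l * pr rho f l.
Proof.
move=> mf; pose h l (x : Omega) : \bar R := (phi l * \1_(f @^-1` [set l]) x)%:E.
have ih l : rho.-integrable setT (h l).
  apply: (@bounded_integrable _ _ `|phi l|).
    by apply: measurable_funM => //; exact: measurable_indic.
  move=> x; rewrite normrM ler_piMr// indicE; case: (_ \in _); rewrite ?normr1// normr0//.
have -> : \int[rho]_x phi (f x) = fine (\int[rho]_x \sum_l h l x)%E.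
  congr fine; apply: eq_integral => x _.
  rewrite (bigD1 (f x))//= big1 ?adde0.
    by rewrite /h indicE mem_set// mulr1.
  by move=> l lf; rewrite /h indicE memNset ?mulr0//= => /esym/eqP; exact/negP.
rewrite integral_sum//.
have -> : (\sum_l \int[rho]_x h l x)%E = (\sum_l (phi l * pr rho f l)%:E)%E.
  apply: eq_bigr => l _; rewrite /h.
  under eq_integral do rewrite EFinM.
  rewrite integralZl//.
    rewrite integral_indic// setIT EFinM fineK// fin_num_measure//.
  apply: (@bounded_integrable _ _ 1); first exact: measurable_indic.
  by move=> x; rewrite indicE; case: (_ \in _); rewrite ?normr1// normr0.
by rewrite sumEFin.
Qed.

Lemma sum_pr rho L (f : Omega -> L) : observable f -> \sum_l pr rho f l = 1.
Proof.
move=> mf; have := @Rintegral_obs rho L f (fun=> 1) mf.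
rewrite Rintegral_cst// [fine _](congr1 fine (probability_setT rho)) mulr1 => ->.
by apply: eq_bigr => l _; rewrite mul1r.
Qed.

Lemma prob_obs rho L (f : Omega -> L) (P : pred L) : observable f ->
  fine (rho [set x | P (f x)]) = \sum_(l | P l) pr rho f l.
Proof.
move=> mf; have := @Rintegral_obs rho L f (fun l => (P l)%:R) mf.
have mP : measurable [set x | P (f x)] by exact: (@observable_preimage _ f P).
have -> : \int[rho]_x (P (f x))%:R = fine (rho [set x | P (f x)]).
  rewrite -[in RHS](setIT [set x | P (f x)]) -integral_indic//; congr fine.
  apply: eq_integral => x _; rewrite indicE; congr ((nat_of_bool _)%:R%:E).
  by apply/idP/idP => [Px|/set_mem//]; exact: mem_set.
move=> ->; rewrite [RHS]big_mkcond; apply: eq_bigr => l _.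
by case: (P l); rewrite ?mul1r ?mul0r.
Qed.

(** Change of variables for the finite laws; it moves sums between a joint law
    and its marginals. *)
Lemma sum_pr_comp rho L K (g : L -> K) (f : Omega -> L) (phi : K -> R) :
  observable f ->
  \sum_k phi k * pr rho (g \o f) k = \sum_l phi (g l) * pr rho f l.
Proof.
move=> mf; rewrite -Rintegral_obs; last exact: observable_comp.
exact: (@Rintegral_obs rho L f (phi \o g)).
Qed.

Lemma pr_comp_ge rho L K (g : L -> K) (f : Omega -> L) l :
  observable f -> pr rho f l <= pr rho (g \o f) (g l).
Proof.
move=> mf; have mgf : observable (g \o f) by exact: observable_comp.
have := mf l; have := mgf (g l) => m1 m2.
apply: fine_le; rewrite ?fin_num_measure//.
by apply: le_measure; rewrite ?inE// => x /= ->.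
Qed.

(** The law of [g \o f] dominates that of [f] pointwise along [g], so
    coarsening an observable cannot increase its entropy. *)
Lemma shannon_comp rho L K (g : L -> K) (f : Omega -> L) : observable f ->
  shannon (pr rho (g \o f)) <= shannon (pr rho f).
Proof.
move=> mf; rewrite /shannon lerN2.
under [leRHS]eq_bigr do rewrite mulrC.
rewrite (@sum_pr_comp rho _ _ g f (fun k => ln (pr rho (g \o f) k)))//.
apply: ler_sum => l _; have [pl|pl] := ltP 0 (pr rho f l); last first.
  have -> : pr rho f l = 0 by apply/eqP; rewrite eq_le pl pr_ge0.
  by rewrite mulr0 mul0r.
rewrite mulrC ler_pM2r// ler_ln ?posrE//.
  exact: pr_comp_ge.
by rewrite (lt_le_trans pl)// pr_comp_ge.
Qed.

End observables.

(** * Entropy of itineraries *)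

Section entropy.
Context {R : realType} {d : nat}.
Local Notation Omega := (Omega R d).
Local Notation prob := (probability Omega R).
Local Notation sym := 'I_d.+1.
Implicit Types (L K : finType) (rho : prob).

Lemma iter_shiftO i (x : Omega) k : iter i shiftO x k = x (k + i)%N.
Proof.
elim: i x k => [|i IH] x k; first by rewrite addn0.
by rewrite iterS /shiftO IH addSnnS.
Qed.

Lemma agree_shift m i (x y : Omega) :
  agree (m + i) x y -> agree m (iter i shiftO x) (iter i shiftO y).
Proof. by move=> xy k km; rewrite !iter_shiftO xy// ltn_add2r. Qed.

Lemma local_shift i : local_map (fun x : Omega => iter i shiftO x).
Proof. by move=> m; exists (m + i)%N => x y; exact: agree_shift. Qed.

Lemma measurable_shift i : measurable_fun setT (fun x : Omega => iter i shiftO x).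
Proof. exact: local_measurable (local_shift i). Qed.

Lemma invariant_iter rho i B : invariant_prob rho -> measurable B ->
  rho ((fun x => iter i shiftO x) @^-1` B) = rho B.
Proof.
move=> inv mB; elim: i => [|i IH]; first by [].
rewrite -[RHS]IH -(inv ((fun x => iter i shiftO x) @^-1` B)); last first.
  by rewrite -[X in measurable X]setTI; exact: measurable_shift.
by congr (rho _); apply/funext => x; exact: (congr1 B (iterSr i shiftO x)).
Qed.

Lemma pr_shift rho L (f : Omega -> L) i : invariant_prob rho -> observable f ->
  pr rho (f \o (fun x => iter i shiftO x)) = pr rho f.
Proof.
move=> inv mf; apply/funext => l; rewrite /pr -(invariant_iter i inv (mf l)).
by [].
Qed.

(** Gibbs' inequality with the product of the two marginals as weights. *)
Lemma shannon_pair rho L K (f : Omega -> L) (g : Omega -> K) :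
  observable f -> observable g ->
  shannon (pr rho (fun x => (f x, g x))) <= shannon (pr rho f) + shannon (pr rho g).
Proof.
move=> mf mg; have mfg := observable_pair mf mg.
set p := pr rho _.
have p1 (l : L * K) : p l <= pr rho f l.1 by exact: (pr_comp_ge rho fst l mfg).
have p2 (l : L * K) : p l <= pr rho g l.2 by exact: (pr_comp_ge rho snd l mfg).
have q0 (l : L * K) : 0 <= pr rho f l.1 * pr rho g l.2.
  by rewrite mulr_ge0 ?pr_ge0.
have pq (l : L * K) : 0 < p l -> 0 < pr rho f l.1 * pr rho g l.2.
  by move=> pl; rewrite mulr_gt0// (lt_le_trans pl).
have := gibbs_ineq (pr_ge0 _ _) (sum_pr _ mfg) q0 pq.
rewrite -/p.
have -> : \sum_(l : L * K) pr rho f l.1 * pr rho g l.2 = 1.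
  rewrite -(pair_bigA _ (fun l k => pr rho f l * pr rho g k))/=.
  under eq_bigr do rewrite -mulr_sumr sum_pr// mulr1.
  exact: sum_pr.
have -> : \sum_l p l * ln (pr rho f l.1 * pr rho g l.2) =
    \sum_l ln (pr rho f l.1) * p l + \sum_l ln (pr rho g l.2) * p l.
  rewrite -big_split; apply: eq_bigr => l _ /=.
  have [pl|pl] := ltP 0 (p l).
    by rewrite lnM ?posrE ?(lt_le_trans pl)// mulrC mulrDl.
  have -> : p l = 0 by apply/eqP; rewrite eq_le pl pr_ge0.
  by rewrite !mulr0 mul0r addr0.
have := @sum_pr_comp _ _ rho _ _ fst _ (fun l => ln (pr rho f l)) mfg => <-.
have := @sum_pr_comp _ _ rho _ _ snd _ (fun l => ln (pr rho g l)) mfg => <-.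
rewrite ln1 !shannonN.
suff: shannon p + (- shannon (pr rho f) + - shannon (pr rho g)) <= 0 ->
  shannon p <= shannon (pr rho f) + shannon (pr rho g) by [].
by lra.
Qed.

Definition itin (T : Type) (xi : Omega -> T) (n : nat) (x : Omega) : n.-tuple T :=
  [tuple xi (iter (val i) shiftO x) | i < n].

Lemma observable_itin K (xi : Omega -> K) n : observable xi ->
  observable (itin xi n).
Proof.
move=> mxi; apply: observable_tuple => i.
exact: (observable_map (measurable_shift i) mxi).
Qed.

Lemma join_entropyE rho k (xi : Omega -> 'I_k) n :
  join_entropy rho xi n = shannon (pr rho (itin xi n)).
Proof.
rewrite /join_entropy /shannon; congr (- _); apply: eq_bigr => w _.
rewrite /pr (_ : join_atom xi w = itin xi n @^-1` [set w])//.
apply/seteqP; split=> x /=.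
  by move=> xw; apply: eq_from_tnth => i; rewrite tnth_mktuple xw.
by move=> <- i; rewrite tnth_mktuple.
Qed.

Lemma join_entropy_subadditive rho k (xi : Omega -> 'I_k) m n :
  invariant_prob rho -> finite_partition xi ->
  join_entropy rho xi (m + n) <= join_entropy rho xi m + join_entropy rho xi n.
Proof.
move=> inv mxi; rewrite !join_entropyE.
have mm := @observable_itin _ xi m mxi; have mn := @observable_itin _ xi n mxi.
rewrite -(pr_shift m inv mn).
have mn' := observable_map (measurable_shift m) mn.
apply: le_trans (shannon_pair rho mm mn').
pose g (w : m.-tuple 'I_k * n.-tuple 'I_k) := cat_tuple w.1 w.2.
rewrite (_ : itin xi (m + n) = g \o (fun x =>
  (itin xi m x, (itin xi n \o (fun x => iter m shiftO x)) x))).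
  by apply: shannon_comp; exact: observable_pair.
apply/funext => x; apply: eq_from_tnth => i.
rewrite tnth_mktuple /g /= -[i]splitK; case: (fintype.split i) => j /=.
  by rewrite tnth_lshift tnth_mktuple.
by rewrite tnth_rshift tnth_mktuple addnC iterD.
Qed.

Lemma join_entropy_ge0 rho k (xi : Omega -> 'I_k) n :
  finite_partition xi -> 0 <= join_entropy rho xi n.
Proof.
move=> mxi; rewrite join_entropyE; apply: shannon_ge0; first exact: pr_ge0.
by apply: sum_pr; exact: observable_itin.
Qed.

(** Subadditivity along an invariant measure makes the limit defining the
    partition entropy exist; the entropy rate is then also a lower bound of
    each normalized term. *)
Lemma partition_entropy_lim rho k (xi : Omega -> 'I_k) :
  invariant_prob rho -> finite_partition xi ->
  ((fun n => n%:R^-1 * join_entropy rho xi n) @ \oo --> partition_entropy rho xi) /\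
  forall n, n%:R * partition_entropy rho xi <= join_entropy rho xi n.
Proof.
move=> inv mxi.
have [l hl ln] := @fekete R (join_entropy rho xi)
  (fun n => join_entropy_ge0 rho n mxi)
  (fun m n => join_entropy_subadditive m n inv mxi).
have <- : l = partition_entropy rho xi by apply/esym/cvg_lim.
by split.
Qed.

Lemma sum_tuple_prod K n (G : 'I_n -> K -> R) :
  \sum_(w : n.-tuple K) \prod_(i < n) G i (tnth w i) = \prod_(i < n) \sum_b G i b.
Proof.
rewrite bigA_distr_bigA.
rewrite (reindex (fun w : n.-tuple K => [ffun i => tnth w i])) /=.
  by apply: eq_bigr => w _; apply: eq_bigr => i _; rewrite ffunE.
exists (fun f : {ffun 'I_n -> K} => [tuple f i | i < n]) => [w _|f _].
  by apply: eq_from_tnth => i; rewrite tnth_mktuple ffunE.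
by apply/ffunP => i; rewrite ffunE tnth_mktuple.
Qed.

(** The letters of [u] at positions i, ..., i + m - 1 (meant for m + i <= N,
    otherwise padding letters enter). *)
Definition window m i N (u : N.-tuple sym) : m.-tuple sym :=
  word m (iter i shiftO (pad u : Omega)).

Lemma window_word m i N (x : Omega) : (m + i <= N)%N ->
  window m i (word N x) = word m (iter i shiftO x).
Proof.
move=> h; apply/word_agree/agree_shift; apply: agreeW h _.
exact: pad_agree.
Qed.

(** Gibbs' inequality for the joint law of the word of length n + m and the
    itinerary of length n. The weight of a pair (u, w) is exp (f u) times
    exp (- t) for each i < n at which w_i differs from the value
    psi (u_i ... u_(i+m-1)) predicted from the word. Summing the weights over w
    gives at most a factor 1 + #|K| exp (- t) per place, and by invariance a
    mismatch occurs at each place with probability at most delta. *)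
Lemma entropy_pressure_ineq rho K (xi : Omega -> K) m (psi : m.-tuple sym -> K)
    (delta t : R) n (f : (n + m).-tuple sym -> R) :
  invariant_prob rho -> observable xi -> 0 <= t ->
  fine (rho [set x | xi x != psi (word m x)]) <= delta ->
  shannon (pr rho (itin xi n)) + \sum_u f u * pr rho (word (n + m)) u <=
  ln (\sum_u expR (f u)) + n%:R * (ln (1 + #|K|%:R * expR (- t)) + t * delta).
Proof.
move=> inv mxi t0 hdelta.
have mw := @observable_word R d (n + m); have mi := @observable_itin _ xi n mxi.
have mL := observable_pair mw mi.
set p := pr rho (fun x => (word (n + m) x, itin xi n x)).
pose bad (i : 'I_n) (l : (n + m).-tuple sym * n.-tuple K) :=
  tnth l.2 i != psi (window m i l.1).
pose q l := expR (f l.1) * \prod_(i < n) expR (- t * (bad i l)%:R).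
have q0 l : 0 < q l by rewrite mulr_gt0 ?expR_gt0// prodr_gt0// => i _; exact: expR_gt0.
have lnq l : ln (q l) = f l.1 - t * \sum_(i < n) (bad i l)%:R.
  by rewrite /q -expR_sum -expRD expRK -mulr_sumr mulNr.
have := @gibbs_ineq R _ p q (pr_ge0 _ _) (sum_pr _ mL) (fun l => ltW (q0 l))
  (fun l _ => q0 l).
have -> : \sum_l p l * ln (q l) = \sum_u f u * pr rho (word (n + m)) u
    - t * \sum_(i < n) \sum_(l | bad i l) p l.
  under eq_bigr do rewrite lnq mulrBr mulrCA [X in X - _]mulrC.
  rewrite sumrB -mulr_sumr; congr (_ - t * _).
    by rewrite -(@sum_pr_comp _ _ rho _ _ fst _ f mL).
  under eq_bigr do rewrite mulr_sumr.
  rewrite exchange_big; apply: eq_bigr => i _; rewrite [RHS]big_mkcond.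
  by apply: eq_bigr => l _; case: (bad i l); rewrite ?mulr1 ?mulr0.
have badi (i : 'I_n) : \sum_(l | bad i l) p l <= delta.
  rewrite -(prob_obs rho (bad i) mL); apply: le_trans hdelta.
  have mB : measurable [set x | xi x != psi (word m x)].
    exact: (@observable_preimage _ _ _ _ [set l | l.1 != psi l.2]
      (observable_pair mxi (@observable_word R d m))).
  rewrite -[X in _ <= fine X](invariant_iter i inv mB) le_eqVlt; apply/orP; left.
  apply/eqP; congr (fine (rho _)); apply/seteqP.
  by split=> x; rewrite /= /bad /= tnth_mktuple window_word// addnC leq_add2r ltnW.
have sbad : t * \sum_(i < n) \sum_(l | bad i l) p l <= n%:R * (t * delta).
  rewrite mulrCA ler_wpM2l//; apply: (@le_trans _ _ (\sum_(i < n) delta)).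
    exact: ler_sum.
  by rewrite sumr_const card_ord mulr_natl.
have Z0 : 0 < \sum_u expR (f u).
  rewrite (bigD1 [tuple ord0 | _ < n + m])//= ltr_pwDl ?expR_gt0//.
  by apply: sumr_ge0 => *; exact: expR_ge0.
have k0 : 0 < 1 + #|K|%:R * expR (- t).
  by rewrite ltr_pwDl// mulr_ge0 ?expR_ge0.
(* For fixed u the weights factor over the places i < n: the matching label
   contributes 1 and every other label exp (- t). *)
have sumq : \sum_l q l <= (\sum_u expR (f u)) * (1 + #|K|%:R * expR (- t)) ^+ n.
  rewrite /q -(pair_bigA _ (fun u w => expR (f u) *
    \prod_(i < n) expR (- t * (bad i (u, w))%:R)))/= mulr_suml.
  apply: ler_sum => u _; rewrite -mulr_sumr ler_wpM2l ?expR_ge0//.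
  rewrite (sum_tuple_prod (fun i b => expR (- t * (b != psi (window m i u))%:R))).
  rewrite -[X in _ ^+ X]card_ord -prodr_const; apply: ler_prod => i _.
  rewrite sumr_ge0/=; last by move=> *; exact: expR_ge0.
  rewrite (bigD1 (psi (window m i u)))//= eqxx mulr0 expR0 lerD2l.
  apply: (@le_trans _ _ (\sum_(b : K) expR (- t))); last first.
    by rewrite sumr_const mulr_natl.
  rewrite big_mkcond; apply: ler_sum => b _.
  by case: (b != _); rewrite ?mulr1// expR_ge0.
have Hle : shannon (pr rho (itin xi n)) <= shannon p.
  exact: (@shannon_comp _ _ rho _ _ snd _ mL).
have lnsum : ln (\sum_l q l) <= ln (\sum_u expR (f u))
    + n%:R * ln (1 + #|K|%:R * expR (- t)).
  rewrite mulr_natl -lnXn// -lnM ?posrE ?exprn_gt0// ler_ln ?posrE//.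
    rewrite (bigD1 ([tuple ord0 | _ < n + m], itin xi n (fun=> ord0)))//= ltr_pwDl//.
    by apply: sumr_ge0 => *; exact: ltW.
  by rewrite mulr_gt0// exprn_gt0.
rewrite mulrDr; move: Hle lnsum sbad.
move: (shannon _) (shannon _) (t * _) (ln _) (ln _) (n%:R * _) (n%:R * _).
by move=> *; lra.
Qed.

(** Approximate each atom by a cylinder set within delta / k; psi selects an
    atom whose cylinder set contains the word, and is right off the union of
    the k symmetric differences. *)
Lemma partition_approx rho k (xi : Omega -> 'I_k) (delta : R) :
  finite_partition xi -> 0 < delta ->
  exists m (psi : m.-tuple sym -> 'I_k),
    fine (rho [set x | xi x != psi (word m x)]) <= delta.
Proof.
move=> mxi delta0.
have k0 : (0 < k)%N by apply: leq_ltn_trans (ltn_ord (xi (fun=> ord0))).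
have dk0 : 0 < delta / k%:R by rewrite divr_gt0// ltr0n.
have /choice[C hC] (i : 'I_k) : exists C, cylinder C /\
    (rho (xi @^-1` [set i] `+` C) <= (delta / k%:R)%:E)%E.
  have [_ /(_ _ dk0)[C cC rC]] := measurable_approximable rho (mxi i).
  by exists C.
have /choice[mC hmC] (i : 'I_k) : exists m, depends m (C i) by case: (hC i).
pose m := \max_i mC i.
have dC i : depends m (C i) by apply: dependsW (hmC i); exact: leq_bigmax.
pose psi (u : m.-tuple sym) : 'I_k := odflt (xi (pad u)) [pick i | `[< C i (pad u) >]].
exists m, psi; pose B i := xi @^-1` [set i] `+` C i.
have mB i : measurable (B i).
  by apply: measurable_setY (mxi i) _; apply: cylinder_measurable; case: (hC i).
have [mU leU] : measurable (\big[setU/set0]_i B i) /\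
    (rho (\big[setU/set0]_i B i) <= \sum_i rho (B i))%E.
  elim/big_rec2: _ => [|i S y _ [mS le]]; first by rewrite measure0.
  split; first exact: measurableU.
  by apply: le_trans (measureU2 _ _ _) _ => //; rewrite leeD2l.
rewrite -lee_fin fineK; last first.
  rewrite fin_num_measure//.
  exact: (@observable_preimage _ _ _ _ [set l | l.1 != psi l.2]
      (observable_pair mxi (@observable_word R d m))).
apply: (@le_trans _ _ (rho (\big[setU/set0]_i B i))).
  apply: le_measure; rewrite ?inE//.
    exact: (@observable_preimage _ _ _ _ [set l | l.1 != psi l.2]
      (observable_pair mxi (@observable_word R d m))).
  move=> x /= xpsi; rewrite -bigcup_seq; apply: contrapT => nB; move/eqP: xpsi; apply.
  have {}nB i : C i x <-> xi x = i.
    have : ~ B i x by move=> Bx; apply: nB; exists i => //=; rewrite mem_index_enum.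
    rewrite /B setY_def /=; have := EM (C i x); have := EM (xi x = i); tauto.
  have CC i : C i (pad (word m x)) <-> xi x = i.
    rewrite -nB; split; apply: dC; first exact: pad_agree.
    exact/agree_sym/pad_agree.
  rewrite /psi; case: pickP => [i /asboolP/CC//|/(_ (xi x))/asboolP []].
  exact/CC.
apply: (le_trans leU); apply: (@le_trans _ _ (\sum_(i < k) (delta / k%:R)%:E)%E).
  by apply: lee_sum => i _; exact: (hC i).2.
by rewrite sumEFin sumr_const card_ord -[(_ / _) *+ k]mulr_natr divfK// pnatr_eq0 -lt0n.
Qed.

End entropy.

(** * Integrals of uniformly continuous functions *)

Section uniformly_continuous.
Context {R : realType} {d : nat}.
Local Notation Omega := (Omega R d).
Local Notation prob := (probability Omega R).
Implicit Types (rho nu : prob) (f g : Omega -> R).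

(** Finitely many words of a suitable length determine the function up to
    1. *)
Lemma unif_cont_bounded f : unif_cont f ->
  exists2 M, 0 <= M & forall x, `|f x| <= M.
Proof.
move=> /(_ 1 ltr01)[m hm].
exists (1 + \sum_(u : m.-tuple 'I_d.+1) `|f (pad u)|).
  by rewrite addr_ge0// sumr_ge0.
move=> x; have := ltW (hm _ _ (agree_sym (@pad_agree _ _ m x))).
rewrite (bigD1 (word m x))//= => h.
have : 0 <= \sum_(u | u != word m x) `|f (pad u)| by rewrite sumr_ge0.
have : `|f x| <= `|f x - f (pad (word m x))| + `|f (pad (word m x))|.
  by rewrite -[X in `|X| <= _](subrK (f (pad (word m x)))) ler_normD.
by move: h; lra.
Qed.

Lemma unif_cont_integrable rho f : unif_cont f -> rho.-integrable setT (EFin \o f).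
Proof.
move=> uf; have [M _ fM] := unif_cont_bounded uf.
exact: bounded_integrable (unif_cont_measurable uf) fM.
Qed.

Lemma unif_cont_local f (phi : Omega -> Omega) :
  unif_cont f -> local_map phi -> unif_cont (f \o phi).
Proof.
move=> uf lphi e /uf[m hm]; have [m' hm'] := lphi m.
by exists m' => x y /hm' /hm.
Qed.

Lemma unif_contD f g : unif_cont f -> unif_cont g -> unif_cont (fun x => f x + g x).
Proof.
move=> uf ug e e0; have e20 : 0 < e / 2 by rewrite divr_gt0.
have [m hm] := uf _ e20; have [m' hm'] := ug _ e20.
exists (maxn m m') => x y xy.
have := hm _ _ (agreeW (leq_maxl _ _) xy).
have := hm' _ _ (agreeW (leq_maxr _ _) xy).
have := ler_normD (f x - f y) (g x - g y); rewrite addrACA -opprD.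
by lra.
Qed.

Lemma unif_cont_lipschitz f (h : R -> R) M K : unif_cont f ->
  (forall x, `|f x| <= M) -> 0 <= K ->
  (forall a b, `|a| <= M -> `|b| <= M -> `|h a - h b| <= K * `|a - b|) ->
  unif_cont (h \o f).
Proof.
move=> uf fM K0 hK e e0; have K1 : 0 < K + 1 by rewrite ltr_wpDl.
have [m hm] := uf _ (divr_gt0 e0 K1).
exists m => x y /hm fxy; apply: le_lt_trans (hK _ _ (fM x) (fM y)) _.
move: fxy; rewrite ltr_pdivlMr// => fxy.
by have := normr_ge0 (f x - f y); lra.
Qed.

Lemma unif_contZ f k : unif_cont f -> unif_cont (fun x => k * f x).
Proof.
move=> uf; have [M _ fM] := unif_cont_bounded uf.
apply: (@unif_cont_lipschitz f (fun a => k * a) M `|k|) => // a b _ _.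
by rewrite -mulrBr normrM.
Qed.

Lemma Rintegral_close rho f g c :
  rho.-integrable setT (EFin \o f) -> rho.-integrable setT (EFin \o g) ->
  (forall x, `|f x - g x| <= c) -> `|\int[rho]_x f x - \int[rho]_x g x| <= c.
Proof.
move=> intf intg fg; rewrite -RintegralB//.
apply: le_trans (le_normr_Rintegral _ _) _ => //.
  by have := integrableB measurableT intf intg.
have -> : c = \int[rho]_(x in setT) c.
  by rewrite Rintegral_cst// [fine _](congr1 fine (probability_setT rho)) mulr1.
apply: le_Rintegral => //.
  by have := integrable_abse (integrableB measurableT intf intg).
exact: (@bounded_integrable _ _ _ _ `|c|).
Qed.

Lemma Rintegral_word rho m f :
  \int[rho]_x f (pad (word m x)) = \sum_u f (pad u) * pr rho (word m) u.
Proof. exact: (@Rintegral_obs _ _ rho _ (word m) (fun u => f (pad u)) (@observable_word R d m)). Qed.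

Lemma unif_cont_word m f : unif_cont (fun x => f (pad (word m x))).
Proof.
by move=> e e0; exists m => x y /word_agree ->; rewrite subrr normr0.
Qed.

Lemma unif_cont_sum n (f : 'I_n -> Omega -> R) :
  (forall i, unif_cont (f i)) -> unif_cont (fun x => \sum_i f i x).
Proof.
elim: n f => [|n IH] f uf.
  by move=> e e0; exists 0%N => x y _; rewrite !big_ord0 subrr normr0.
rewrite (_ : (fun x => _) = (fun x => \sum_(i < n) f (widen_ord (leqnSn n) i) x
   + f ord_max x)); last by apply/funext => x; rewrite big_ord_recr.
by apply: unif_contD => //; apply: IH.
Qed.

(** A measure that is an average of images of [nu] integrates functions
    accordingly. For functions of a word this is a finite computation with
    laws, and a uniformly continuous function is a uniform limit of those. *)
Lemma mean_average rho nu n (phi : 'I_n -> Omega -> Omega) f :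
  (0 < n)%N -> unif_cont f -> (forall i, local_map (phi i)) ->
  (forall B, measurable B ->
    fine (rho B) = n%:R^-1 * \sum_i fine (nu (phi i @^-1` B))) ->
  mean rho f = \int[nu]_x (n%:R^-1 * \sum_i f (phi i x)).
Proof.
move=> n0 uf lphi rhonu; apply/eqP; rewrite -subr_eq0 -normr_eq0 eq_le normr_ge0 andbT.
apply/ler_addgt0Pr => e e0; rewrite add0r.
have e20 : 0 < e / 2 by rewrite divr_gt0.
have [m hm] := uf _ e20.
have close x : `|f x - f (pad (word m x))| <= e / 2.
  by apply/ltW/hm/agree_sym/pad_agree.
have c1 : `|mean rho f - \int[rho]_x f (pad (word m x))| <= e / 2.
  apply: Rintegral_close => //; apply: unif_cont_integrable => //.
  exact: unif_cont_word.
have uavg g : unif_cont g -> unif_cont (fun x => n%:R^-1 * \sum_i g (phi i x)).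
  move=> ug; apply: unif_contZ; apply: unif_cont_sum => i.
  exact: (unif_cont_local ug (lphi i)).
have c2 : `|\int[nu]_x (n%:R^-1 * \sum_i f (pad (word m (phi i x)))) -
    \int[nu]_x (n%:R^-1 * \sum_i f (phi i x))| <= e / 2.
  apply: Rintegral_close.
  - by apply: unif_cont_integrable; apply: uavg (@unif_cont_word m f).
  - by apply: unif_cont_integrable; exact: uavg.
  move=> x; rewrite -mulrBr -sumrB normrM ger0_norm ?invr_ge0//.
  rewrite ler_pdivrMl ?ltr0n//; apply: le_trans (ler_norm_sum _ _ _) _.
  apply: (@le_trans _ _ (\sum_(i < n) (e / 2))).
    by apply: ler_sum => i _; rewrite distrC.
  by rewrite sumr_const card_ord mulr_natl.
have E : \int[rho]_x f (pad (word m x)) =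
    \int[nu]_x (n%:R^-1 * \sum_i f (pad (word m (phi i x)))).
  have mw i : observable (word m \o phi i).
    by apply: observable_map; [exact: local_measurable|exact: observable_word].
  pose L x := [tuple word m (phi i x) | i < n].
  have mL : observable L by apply: observable_tuple.
  rewrite Rintegral_word.
  rewrite (_ : (fun x => _) = (fun x => n%:R^-1 * \sum_i f (pad (tnth (L x) i)))); last first.
    by apply/funext => x; congr (_ * _); apply: eq_bigr => i _; rewrite tnth_mktuple.
  rewrite (@Rintegral_obs _ _ nu _ L (fun w => n%:R^-1 * \sum_i f (pad (tnth w i))) mL).
  transitivity (\sum_u \sum_i n%:R^-1 * (f (pad u) * pr nu (word m \o phi i) u)).
    apply: eq_bigr => u _; rewrite -mulr_sumr -mulr_sumr mulrCA.
    by congr (_ * _); rewrite /pr rhonu//; exact: observable_word.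
  transitivity (\sum_w \sum_i n%:R^-1 * (f (pad (tnth w i)) * pr nu L w)); last first.
    by apply: eq_bigr => w _; rewrite -mulr_sumr -mulr_suml mulrA.
  rewrite exchange_big [RHS]exchange_big; apply: eq_bigr => i _ /=.
  rewrite -!mulr_sumr; congr (_ * _).
  rewrite -(@sum_pr_comp _ _ nu _ _ (fun w => tnth w i) L (fun u => f (pad u)) mL).
  apply: eq_bigr => u _; congr (_ * pr nu _ _); apply/funext => x /=.
  by rewrite tnth_mktuple.
rewrite -E in c2.
have := ler_normD (mean rho f - \int[rho]_x f (pad (word m x)))
  (\int[rho]_x f (pad (word m x)) - \int[nu]_x (n%:R^-1 * \sum_i f (phi i x))).
rewrite addrA subrK; move: c1 c2.
move: `|_ - _| `|_ - _| `|_ - _| => u v w; lra.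
Qed.

Lemma unif_cont_birkhoff f n : unif_cont f -> unif_cont (birkhoff_avg f n).
Proof.
move=> uf; apply: unif_contZ.
rewrite (_ : (fun x => _) = (fun x => \sum_(i < n) f (iter i shiftO x))).
  by apply: unif_cont_sum => i; exact: (unif_cont_local uf (local_shift i)).
by apply/funext => x; rewrite big_mkord.
Qed.

Lemma mean_birkhoff rho f n : (0 < n)%N -> invariant_prob rho -> unif_cont f ->
  \int[rho]_x birkhoff_avg f n x = mean rho f.
Proof.
move=> n0 inv uf.
rewrite (@mean_average rho rho n (fun i x => iter i shiftO x) f)//.
- by congr (fine _); apply: eq_integral => x _; rewrite /birkhoff_avg big_mkord.
- by move=> i; exact: local_shift.
- move=> B mB; rewrite (eq_bigr (fun=> fine (rho B))); last first.
    by move=> i _; rewrite invariant_iter.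
  rewrite sumr_const card_ord -[fine _ *+ n]mulr_natl mulKf// pnatr_eq0 -lt0n//.
Qed.

Lemma birkhoff_bounded f M n x : 0 <= M -> (forall y, `|f y| <= M) ->
  `|birkhoff_avg f n x| <= M.
Proof.
move=> M0 fM; rewrite /birkhoff_avg normrM ger0_norm ?invr_ge0// big_mkord.
case: n => [|n]; first by rewrite invr0 mul0r.
rewrite ler_pdivrMl ?ltr0n//; apply: le_trans (ler_norm_sum _ _ _) _.
apply: (@le_trans _ _ (\sum_(i < n.+1) M)); first exact: ler_sum.
by rewrite sumr_const card_ord mulr_natl.
Qed.

Lemma mean_bounded rho f M : unif_cont f -> (forall y, `|f y| <= M) ->
  `|mean rho f| <= M.
Proof.
move=> uf fM; have := @Rintegral_close rho f (fun=> 0) M.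
rewrite Rintegral_cst// mul0r subr0; apply.
- exact: unif_cont_integrable.
- by apply: (@bounded_integrable _ _ _ _ 0) => // x; rewrite normr0.
- by move=> x; rewrite subr0.
Qed.

Lemma mean_scale rho f s : unif_cont f -> mean rho (fun x => s * f x) = s * mean rho f.
Proof. by move=> uf; rewrite /mean RintegralZl//; exact: unif_cont_integrable. Qed.

End uniformly_continuous.

(** * Distortion of Birkhoff averages *)

Section holder.
Context {R : realType} {d : nat} (A : Omega R d -> R).
Hypothesis hA : holder A.
Local Notation Omega := (Omega R d).

(** Points agreeing on [n] coordinates are at distance at most 2^-(n+1), so
    r = 2^-alpha works. *)
Lemma holder_geometric : exists r C : R, [/\ 0 <= r < 1, 0 <= C &
  forall n x y, agree n x y -> `|A x - A y| <= C * r ^+ n].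
Proof.
have [a /andP[a0 a1] [C hC]] := hA.
have h0 : 0 < (2^-1 : R) by rewrite invr_gt0.
pose r : R := 2^-1 `^ a.
have r0 : 0 <= r by exact: powR_ge0.
have r1 : r < 1.
  have := @gt0_ltr_powR R a a0 2^-1 1; rewrite powR1; apply; rewrite ?nnegrE ?ltW//.
  by rewrite invf_lt1// ltr1n.
exists r, `|C|; split => //; first by rewrite r0.
move=> n x y xy; apply: (le_trans (hC x y)).
apply: (@le_trans _ _ (`|C| * (mdist x y `^ a))).
  by rewrite ler_wpM2r ?powR_ge0// ler_norm.
rewrite ler_wpM2l//; apply: (@le_trans _ _ ((2^-1 ^+ n.+1) `^ a)).
  apply: ge0_ler_powR; rewrite ?nnegrE ?mdist_ge0 ?exprn_ge0 ?(ltW a0)//.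
  have : distO x y <= 2^-1 ^+ n.+1 by apply/distO_le.
  by [].
rewrite -[_ ^+ n.+1]powR_mulrn ?(ltW h0)// powRAC powR_mulrn// -/r exprS ler_piMl ?exprn_ge0//.
exact: ltW.
Qed.

Lemma holder_unif_cont : unif_cont A.
Proof.
have [r [C [/andP[r0 r1] C0 hC]]] := holder_geometric.
move=> e e0; have C1 : 0 < C + 1 by rewrite ltr_wpDl.
have /cvgrPdist_lt /(_ _ (divr_gt0 e0 C1))[m _ /(_ m (leqnn m))] :
    (fun n => r ^+ n) @ \oo --> (0 : R) by apply: cvg_expr; rewrite ger0_norm.
rewrite /= sub0r normrN ger0_norm ?exprn_ge0// ltr_pdivlMr// => hm.
exists m => x y /hC; have : 0 <= r ^+ m by exact: exprn_ge0.
by move: hm; lra.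
Qed.

(** The i-th terms of the two Birkhoff sums differ by at most C r^(n-i), since
    the shifted points agree on n - i coordinates; the geometric series is
    bounded independently of n. *)
Lemma bounded_distortion : exists2 C, 0 <= C & forall n x y, agree n x y ->
  `|birkhoff_avg A n x - birkhoff_avg A n y| <= n%:R^-1 * C.
Proof.
have [r [C [/andP[r0 r1] C0 hC]]] := holder_geometric.
have r10 : 0 < 1 - r by rewrite subr_gt0.
exists (C / (1 - r)); first by rewrite divr_ge0// ltW.
move=> n x y xy; rewrite /birkhoff_avg -mulrBr normrM ger0_norm ?invr_ge0//.
rewrite ler_wpM2l ?invr_ge0//.
have : `|\sum_(0 <= i < n) A (iter i shiftO x) - \sum_(0 <= i < n) A (iter i shiftO y)|
    <= C * \sum_(i < n) r ^+ i.
  elim: n x y xy => [|n IH] x y xy; first by rewrite !big_geq// subrr normr0 big_ord0 mulr0.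
  rewrite !big_nat_recl//= big_ord_recr/= mulrDr.
  have E z : \sum_(0 <= i < n) A (shiftO (iter i shiftO z)) =
      \sum_(0 <= i < n) A (iter i shiftO (shiftO z)).
    by apply: eq_bigr => i _; rewrite -iterS iterSr.
  have xy' : agree n (shiftO x) (shiftO y).
    by apply: (@agree_shift _ _ n 1); rewrite addn1.
  rewrite !E; have := IH _ _ xy'; have := hC _ _ _ (agreeW (leqnSn n) xy).
  have := ler_normD (A x - A y) (\sum_(0 <= i < n) A (iter i shiftO (shiftO x)) -
    \sum_(0 <= i < n) A (iter i shiftO (shiftO y))).
  rewrite addrACA -opprD; move: (`|_ + _|) (`|_ - _|) (`|_ - _|) => *; lra.
move=> h; apply: (le_trans h); rewrite ler_wpM2l// -[leRHS]mul1r ler_pdivlMr//.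
have := subrX1 r n; rewrite mulrC => e.
have : 0 <= r ^+ n by exact: exprn_ge0.
by rewrite mulrBr mulr1; move: e; rewrite mulrBr mulr1; lra.
Qed.

End holder.

(** * Block codes of the uniform measure *)

Section block_measures.
Context {R : realType} {d : nat}.
Local Notation Omega := (Omega R d).
Local Notation prob := (probability Omega R).
Local Notation sym := 'I_d.+1.
Implicit Types (rho nu mu : prob).

Section average.
Variables (nu : prob) (n : nat) (phi : nat -> {mfun Omega >-> Omega}).

(** The mean of the images of [nu] under phi 0, ..., phi n. *)
Definition average_law : set Omega -> \bar R :=
  mscale n.+1%:R^-1%:nng (msum (fun i => distribution nu (phi i)) n.+1).

HB.instance Definition _ := Measure.on average_law.

Lemma average_lawE B : measurable B ->
  average_law B = (n.+1%:R^-1 * \sum_(i < n.+1) fine (nu (phi i @^-1` B)))%:E.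
Proof.
move=> mB; rewrite /average_law /mscale /msum /= EFinM -sumEFin; congr (_ * _)%E.
apply: eq_bigr => i _; rewrite fineK// fin_num_measure//.
by rewrite -[X in measurable X]setTI; exact: measurable_funPT.
Qed.

Lemma average_law_setT : average_law setT = 1%E.
Proof.
rewrite average_lawE// (eq_bigr (fun=> 1)); last first.
  by move=> i _; rewrite preimage_setT [nu _](probability_setT nu).
by rewrite sumr_const card_ord mulVf.
Qed.

HB.instance Definition _ :=
  Measure_isProbability.Build _ _ _ average_law average_law_setT.

End average.

Lemma average_prob nu n (phi : nat -> Omega -> Omega) : (0 < n)%N ->
  (forall i, measurable_fun setT (phi i)) ->
  exists rho : prob, forall B, measurable B ->
    fine (rho B) = n%:R^-1 * \sum_(i < n) fine (nu (phi i @^-1` B)).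
Proof.
case: n => // n _ mphi.
pose X i : {mfun Omega >-> Omega} :=
  HB.pack (phi i) (isMeasurableFun.Build _ _ _ _ (phi i) (mphi i)).
by exists (average_law nu n X) => B mB; exact: (congr1 fine (average_lawE _ _ _ mB)).
Qed.

Definition block n l (x : Omega) : n.-tuple sym := word n (iter (l * n) shiftO x).

Lemma blockE n l x (i : 'I_n) : tnth (block n l x) i = x (l * n + i)%N.
Proof. by rewrite tnth_mktuple iter_shiftO addnC. Qed.

Lemma observable_block n l : observable (@block n l).
Proof. exact: (observable_map (@measurable_shift R d (l * n)) (@observable_word R d n)). Qed.

(** Disjoint blocks of uniform letters are independent and uniform among the
    words of length n. *)
Lemma uniform_blocks mu n c (E : 'I_c -> {set n.-tuple sym}) : uniform_product mu ->
  (0 < n)%N ->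
  fine (mu [set x | [forall l : 'I_c, block n l x \in E l]]) =
  \prod_(l < c) (#|E l|%:R / #|{: n.-tuple sym}|%:R).
Proof.
move=> hmu n0; pose Bl (x : Omega) := [tuple block n (val l) x | l < c].
have mBl : observable Bl by apply: observable_tuple => l; exact: observable_block.
have prBl e : pr mu Bl e = \prod_(l < c) (#|{: n.-tuple sym}|%:R)^-1.
  pose B (i : 'I_(c * n)) : {set sym} :=
    [set nth ord0 (nth [tuple ord0 | _ < n] e (i %/ n)) (i %% n)]%SET.
  rewrite /pr (_ : Bl @^-1` [set e] = [set x | forall i, x (val i) \in B i]).
    rewrite hmu /= (eq_bigr (fun=> d.+1%:R^-1)); last first.
      by move=> i _; rewrite cards1 mul1r.
    rewrite !prodr_const !card_ord card_tuple card_ord.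
    by rewrite natrX -exprVn -exprM mulnC.
  apply/seteqP; split=> x /=.
    move=> xe i; rewrite /B inE -xe; apply/eqP.
    have ic : (i %/ n < c)%N by rewrite ltn_divLR.
    have im : (i %% n < n)%N by rewrite ltn_mod.
    rewrite -(tnth_nth _ (Bl x) (Ordinal ic)) tnth_mktuple /=.
    rewrite -(tnth_nth _ (block n (i %/ n) x) (Ordinal im)) blockE /=.
    by rewrite -divn_eq.
  move=> xB; apply: eq_from_tnth => l; rewrite tnth_mktuple.
  apply: eq_from_tnth => j; rewrite blockE.
  have lj : (l * n + j < c * n)%N.
    apply: (@leq_trans (l.+1 * n)); last by rewrite leq_mul2r ltn_ord orbT.
    by rewrite mulSn addnC ltn_add2r.
  have := xB (Ordinal lj); rewrite inE /= => /eqP ->.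
  rewrite divnMDl// divn_small// addn0 modnMDl modn_small//.
  by rewrite -!tnth_nth.
pose P (e : c.-tuple (n.-tuple sym)) := [forall l, tnth e l \in E l].
rewrite (_ : [set x | _] = [set x | P (Bl x)]); last first.
  apply/seteqP; split=> x /= /forallP h; apply/forallP => l.
    by rewrite tnth_mktuple; exact: h.
  by have := h l; rewrite tnth_mktuple.
rewrite (prob_obs mu P mBl) big_mkcond /=.
pose G (l : 'I_c) (u : n.-tuple sym) : R :=
  (u \in E l)%:R / #|{: n.-tuple sym}|%:R.
transitivity (\sum_(e : c.-tuple (n.-tuple sym)) \prod_(l < c) G l (tnth e l)).
  apply: eq_bigr => e _; rewrite prBl /G big_split /=.
  case: ifP => [/forallP h|/negbT /forallPn [l hl]].
    by rewrite [X in X * _]big1 ?mul1r// => l _; rewrite h.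
  by rewrite [X in X * _](bigD1 l)//= (negbTE hl) !mul0r.
rewrite sum_tuple_prod; apply: eq_bigr => l _.
rewrite -mulr_suml; congr (_ / _).
rewrite (eq_bigr (fun u => if u \in E l then 1 else 0)); last first.
  by move=> u _; case: (u \in E l).
by rewrite -big_mkcond sumr_const.
Qed.

(** Send the element of rank r to the element of [S] of index r modulo |S|. A
    fibre then has at most |T| / |S| + 1 <= 2 |T| / |S| elements. *)
Lemma balanced_map (T : finType) (S : {set T}) : (0 < #|S|)%N ->
  exists g : T -> T, (forall u, g u \in S) /\
    forall v, (#|[set u | g u == v]%SET| * #|S| <= 2 * #|T|)%N.
Proof.
move=> S0; have [s0 s0S] : exists s, s \in S by apply/set0Pn; rewrite -card_gt0.
have idx (u : T) : (enum_rank u %% #|S| < size (enum S))%N by rewrite -cardE ltn_mod.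
exists (fun u => nth s0 (enum S) (enum_rank u %% #|S|)); split=> [u|v].
  by rewrite -mem_enum mem_nth.
set U := finset _.
have ST : (#|S| <= #|T|)%N by exact: max_card.
pose h (u : T) : 'I_(#|T| %/ #|S|).+1 := inord (enum_rank u %/ #|S|).
have hE u : h u = (enum_rank u %/ #|S|)%N :> nat.
  by rewrite inordK// ltnS leq_div2r// ltnW// ltn_ord.
have hinj : {in U &, injective h}.
  move=> u u'; rewrite !inE => /eqP uv /eqP u'v /(congr1 val) /=; rewrite !hE => q.
  apply: enum_rank_inj; apply: val_inj => /=.
  rewrite (divn_eq (enum_rank u) #|S|) (divn_eq (enum_rank u') #|S|) q; congr (_ + _)%N.
  by apply/eqP; rewrite -(nth_uniq s0 (idx u) (idx u') (enum_uniq _)) uv u'v.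
have : (#|U| <= (#|T| %/ #|S|).+1)%N.
  by rewrite -(card_in_imset hinj) (leq_trans (max_card _))// card_ord.
move=> h1.
apply: leq_trans (_ : (#|T| %/ #|S|).+1 * #|S| <= _)%N; first by rewrite leq_mul2r h1 orbT.
by rewrite mulSn mul2n -addnn leq_add// leq_trunc_div.
Qed.

(** Replaces each of the consecutive blocks of length [n] by its image under
    [g]. *)
Definition code n (g : n.-tuple sym -> n.-tuple sym) (x : Omega) : Omega :=
  fun k => nth ord0 (g (block n (k %/ n) x)) (k %% n).

Lemma local_code n g : local_map (@code n g).
Proof.
move=> m; exists (m + n)%N => x y xy k km; rewrite /code; congr (nth _ (g _) _).
apply/word_agree => j jn; rewrite !iter_shiftO; apply: xy.
by rewrite addnC; apply: leq_ltn_trans (leq_add (leq_trunc_div _ _) (leqnn _)) _; rewrite -addnS leq_add// ltnW.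
Qed.

Lemma block_code n g l x : (0 < n)%N -> block n l (code g x) = g (block n l x).
Proof.
move=> n0; apply: eq_from_tnth => i; rewrite blockE /code.
by rewrite divnMDl// divn_small// addn0 modnMDl modn_small// -tnth_nth.
Qed.

(** The code commutes with the shift by a whole block only; this is why the
    image measure has to be averaged over n shifts. *)
Lemma code_shift n (g : n.-tuple sym -> n.-tuple sym) x : (0 < n)%N ->
  code g (iter n shiftO x) = iter n shiftO (code g x).
Proof.
move=> n0; apply/funext => k; rewrite iter_shiftO /code.
have -> : ((k + n) %/ n = (k %/ n).+1)%N by rewrite divnDr ?dvdnn// divnn n0 addn1.
rewrite modnDr; congr (nth _ (g _) _); apply: eq_from_tnth => i.
by rewrite !blockE iter_shiftO mulSn; congr (x _); move: (_ * n)%N => q; lia.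
Qed.

Lemma pr_uniform_word (mu : prob) n (u : n.-tuple sym) : uniform_product mu ->
  pr mu (word n) u = d.+1%:R^-1 ^+ n.
Proof.
move=> hmu; pose B (i : 'I_n) : {set sym} := [set tnth u i]%SET.
rewrite /pr (_ : word n @^-1` [set u] = [set x | forall i, x (val i) \in B i]).
  rewrite hmu /= (eq_bigr (fun=> d.+1%:R^-1)) ?prodr_const ?card_ord//.
  by move=> i _; rewrite cards1 mul1r.
apply/seteqP; split=> x /=; first by move=> xu i; rewrite /B inE -xu tnth_mktuple.
move=> h; apply: eq_from_tnth => i; rewrite tnth_mktuple.
by have := h i; rewrite inE => /eqP.
Qed.

(** Both measures give the cylinder of a word of length m the mass
    (d+1)^-m: for the shifted one, the first of the m + 1 letters is free. *)
Lemma uniform_invariant mu : uniform_product mu -> invariant_prob mu.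
Proof.
move=> hmu; have [nu hnu] := @average_prob mu 1 (fun _ => shiftO) isT
  (fun _ => @measurable_shift R d 1).
have E B : measurable B -> nu B = mu (shiftO @^-1` B).
  move=> mB; have h := hnu B mB; rewrite big_ord1 invr1 mul1r in h.
  have mB' : measurable (shiftO @^-1` B).
    by rewrite -[X in measurable X]setTI; exact: (@measurable_shift R d 1).
  by rewrite -[LHS]fineK ?fin_num_measure// h fineK// fin_num_measure.
move=> B mB; rewrite -E//; apply: prob_unique => // {mB}C [m dC].
have mC := depends_measurable dC.
rewrite E//.
pose P (u : m.-tuple sym) := `[< C (pad u) >].
have CE (x : Omega) : C x <-> P (word m x).
  split=> [Cx|/asboolP]; last by apply: dC; exact: pad_agree.
  by apply/asboolP; apply: dC Cx; apply/agree_sym/pad_agree.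
have mw := @observable_word R d m.
have mw1 := observable_map (@measurable_shift R d 1) mw.
have e1 : C = [set x | P (word m x)] by apply/seteqP; split=> x /CE.
have e2 : shiftO @^-1` C = [set x | P ((word m \o (fun x => iter 1 shiftO x)) x)].
  by apply/seteqP; split=> x /CE.
rewrite -[LHS]fineK ?fin_num_measure//; last by rewrite e2; exact: (@observable_preimage _ _ _ _ P mw1).
rewrite -[RHS]fineK ?fin_num_measure//; congr EFin.
rewrite e2 e1 (prob_obs mu P mw1) (prob_obs mu P mw); apply: eq_bigr => u _.
rewrite pr_uniform_word//.
pose B1 (i : 'I_m.+1) : {set sym} :=
  if unlift ord0 i is Some j then [set tnth u j]%SET else [set: sym]%SET.
rewrite /pr (_ : _ @^-1` [set u] = [set x | forall i, x (val i) \in B1 i]); last first.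
  apply/seteqP; split=> x /=.
    move=> xu i; rewrite /B1; case: unliftP => [j ->|_]; last by rewrite inE.
    by rewrite inE -xu tnth_mktuple.
  move=> h; apply: eq_from_tnth => i; rewrite tnth_mktuple.
  by have := h (lift ord0 i); rewrite /B1 liftK inE => /eqP.
rewrite hmu /= big_ord_recl /B1 unlift_none cardsT card_ord divff ?pnatr_eq0// mul1r.
rewrite (eq_bigr (fun=> d.+1%:R^-1)) ?prodr_const ?card_ord//.
by move=> i _; rewrite liftK cards1 mul1r.
Qed.

End block_measures.

(** * Invariant measures carried by a set of words *)

Section block_law.
Context {R : realType} {d : nat}.
Local Notation Omega := (Omega R d).
Local Notation prob := (probability Omega R).
Local Notation sym := 'I_d.+1.

Definition coord0 (x : Omega) : sym := x 0%N.

Lemma coord0_partition : finite_partition coord0.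
Proof. by apply: (@observable_local _ _ _ _ 1%N) => x y; apply. Qed.

Lemma itin_coord0 n (x : Omega) : itin coord0 n x = word n x.
Proof.
by apply: eq_from_tnth => i; rewrite !tnth_mktuple /coord0 iter_shiftO.
Qed.

(** Along the lengths (b + 1) n the normalized entropies are at least
    (c / n) b / (b + 1), which tends to c / n. *)
Lemma entropy_rate_ge (rho : prob) k (xi : Omega -> 'I_k) n (c : R) : (0 < n)%N ->
  invariant_prob rho -> finite_partition xi ->
  (forall b, b%:R * c <= join_entropy rho xi (b.+1 * n)) ->
  n%:R^-1 * c <= partition_entropy rho xi.
Proof.
move=> n0 inv mxi Hc; have n0' : 0 < n%:R :> R by rewrite ltr0n.
apply/ler_addgt0Pr => e e0; have e20 : 0 < e / 2 by rewrite divr_gt0.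
have [/cvgrPdist_le /(_ _ e20)[N _ hN] _] := partition_entropy_lim inv mxi.
have [b hb1 hb2] : exists2 b, (N <= b)%N & `|c| / (e / 2) <= b%:R.
  have [N' _ hN'] := nbhs_infty_ger (`|c| / (e / 2)).
  by exists (maxn N N'); [exact: leq_maxl|apply: hN'; exact: leq_maxr].
have Nb : (N <= b.+1 * n)%N.
  by apply: (leq_trans hb1); apply: (leq_trans (leqnSn b)); exact: leq_pmulr.
have := hN _ Nb; rewrite /= ler_distl => /andP[+ _].
have : n%:R^-1 * c - e / 2 <= (b.+1 * n)%:R^-1 * join_entropy rho xi (b.+1 * n).
  apply: (@le_trans _ _ ((b.+1 * n)%:R^-1 * (b%:R * c))); last first.
    by rewrite ler_wpM2l ?invr_ge0// Hc.
  have b0 : 0 < b.+1%:R :> R by rewrite ltr0n.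
  have -> : (b.+1 * n)%:R^-1 * (b%:R * c) = n%:R^-1 * (c - c / b.+1%:R).
    have -> : b%:R = b.+1%:R - 1 :> R by rewrite -natr1 addrK.
    rewrite natrM; move: (b.+1%:R) (n%:R : R) b0 n0' => u v u0 v0.
    by field; rewrite !gt_eqF.
  rewrite mulrBr lerD2l lerN2; apply: (@le_trans _ _ (1 * (`|c| / b.+1%:R))).
    apply: (@le_trans _ _ (n%:R^-1 * (`|c| / b.+1%:R))).
      by rewrite ler_wpM2l ?invr_ge0// ler_wpM2r ?invr_ge0// ler_norm.
    by rewrite ler_wpM2r ?divr_ge0// invf_le1// ler1n.
  rewrite mul1r ler_pdivrMr//.
  move: hb2; rewrite ler_pdivrMr// => hb2; apply: (le_trans hb2).
  by rewrite mulrC ler_wpM2l ?(ltW e20)// ler_nat.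
by move: (_ * c) (_ * join_entropy _ _ _) (partition_entropy _ _) => *; lra.
Qed.

(** The image of the uniform measure under the block code of a balanced map
    onto words of [S], averaged over the shifts by 0, ..., n - 1. *)
Lemma block_law (mu : prob) n (S : {set n.-tuple sym}) :
  uniform_product mu -> (0 < n)%N -> (0 < #|S|)%N ->
  exists rho : prob, [/\ invariant_prob rho,
    forall f a c, unif_cont f ->
      (forall x, word n x \in S -> `|birkhoff_avg f n x - a| <= c) ->
      `|mean rho f - a| <= c &
    n%:R^-1 * (ln #|S|%:R - ln 2) <= partition_entropy rho coord0].
Proof.
move=> hmu n0 S0; have [g [gS gbal]] := balanced_map S0.
pose G : Omega -> Omega := code g.
pose phi i x := iter i shiftO (G x).
have lphi i : local_map (phi i).
  move=> m; have [m1 h1] := @local_shift R d i m; have [m2 h2] := @local_code R d n g m1.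
  by exists m2 => x y /h2 /h1.
have [rho hrho] := @average_prob R d mu n phi n0 (fun i => local_measurable (lphi i)).
have mphi i B : measurable B -> measurable (phi i @^-1` B).
  by move=> mB; rewrite -[X in measurable X]setTI; exact: (local_measurable (lphi i)).
have wordG x : word n (G x) \in S.
  by have := @block_code R d n g 0 x n0; rewrite /block mul0n /= => ->; exact: gS.
have muinv := uniform_invariant hmu.
(* Shifting turns the average over i < n into the one over 0 < i <= n, and the
   term i = n equals the term i = 0 because the code commutes with the n-th
   iterate of the shift, which preserves mu. *)
have inv : invariant_prob rho.
  move=> B mB; have mB' : measurable (shiftO @^-1` B).
    by rewrite -[X in measurable X]setTI; exact: (@measurable_shift R d 1).
  rewrite -[LHS]fineK ?fin_num_measure// -[RHS]fineK ?fin_num_measure//.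
  congr EFin; rewrite !hrho//; congr (_ * _).
  have E i : phi i @^-1` (shiftO @^-1` B) = phi i.+1 @^-1` B by [].
  under eq_bigr do rewrite E.
  case: n n0 S S0 g gS gbal @G @phi lphi hrho mphi wordG E => // n n0 S S0 g gS gbal G phi *.
  rewrite big_ord_recr [RHS]big_ord_recl /= addrC; congr (_ + _).
  rewrite -(invariant_iter n.+1 muinv (B := phi 0%N @^-1` B)); last first.
    by rewrite -[X in measurable X]setTI; exact: (local_measurable (@local_code R d n.+1 g)).
  congr (fine (mu _)); apply/funext => x.
  exact: (congr1 B (esym (code_shift g x n0))).
exists rho; split => //.
- move=> f a c uf hf.
  rewrite (@mean_average R d rho mu n (fun i => phi i) f n0 uf (fun i => lphi i) hrho).
  have -> : a = \int[mu]_(x in setT) a.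
    by rewrite Rintegral_cst// [fine _](congr1 fine (probability_setT mu)) mulr1.
  have uavg : unif_cont (fun x => n%:R^-1 * \sum_(i < n) f (phi i x)).
    by apply: unif_contZ; apply: unif_cont_sum => i; exact: (unif_cont_local uf (lphi i)).
  apply: Rintegral_close; first exact: unif_cont_integrable.
    by apply: (@bounded_integrable _ _ _ _ `|a|).
  by move=> x; have := hf _ (wordG x); rewrite /birkhoff_avg big_mkord.
- apply: (entropy_rate_ge n0 inv coord0_partition) => b; set k := (b.+1 * n)%N.
  have S0' : 0 < #|S|%:R :> R by rewrite ltr0n.
  have -> : b%:R * (ln #|S|%:R - ln 2) = - ln ((2 / #|S|%:R : R) ^+ b).
    by rewrite lnXn ?divr_gt0// ln_div ?posrE// -[(_ - _) *+ b]mulr_natl -mulrN opprB.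
  rewrite join_entropyE; have mk := observable_itin (n := k) coord0_partition.
  apply: shannon_ge; [by rewrite exprn_gt0 ?divr_gt0|exact: pr_ge0|exact: sum_pr|].
  move=> w; rewrite /pr hrho; last exact: mk.
  rewrite ler_pdivrMl ?ltr0n//.
  apply: (@le_trans _ _ (\sum_(i < n) ((2 / #|S|%:R : R) ^+ b))); last first.
    by rewrite sumr_const card_ord [leRHS]mulr_natl.
  apply: ler_sum => i _.
  pose v (l : nat) : n.-tuple sym := word n (iter (l * n - i) shiftO (pad w : Omega)).
  (* A window of length (b+1)n starting at i < n contains the blocks 1, ..., b,
     whose images under g are therefore read off from w; block 0 may be cut and
     is left free. *)
  pose E (l : 'I_b.+1) : {set n.-tuple sym} :=
    if val l is 0%N then [set: n.-tuple sym]%SET else [set u | g u == v l]%SET.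
  pose W : set Omega := [set x | [forall l : 'I_b.+1, block n l x \in E l]].
  have mW : measurable W.
    have mBl : observable (fun x : Omega => [tuple block n (val l) x | l < b.+1]).
      by apply: observable_tuple => l; exact: observable_block.
    have := @observable_preimage _ _ _ _ [set e | [forall l, tnth e l \in E l]] mBl.
    rewrite (_ : _ @^-1` _ = W)//; apply/seteqP; split=> x /= /forallP h; apply/forallP => l.
      by have := h l; rewrite tnth_mktuple.
    by rewrite tnth_mktuple; exact: h.
  have sub : phi i @^-1` (itin coord0 k @^-1` [set w]) `<=` W.
    move=> x /= xw; apply/forallP => l; rewrite /E.
    case: l => -[|l] /= lb; first by rewrite inE.
    rewrite inE; apply/eqP; rewrite -block_code// /v /block.
    have il : (i <= l.+1 * n)%N by rewrite mulSn (leq_trans (ltnW (ltn_ord i)))// leq_addr.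
    rewrite -{1}(subnK il) iterD; apply/word_agree/agree_shift.
    apply: (@agreeW _ _ _ k); last first.
      by apply/word_agree; rewrite padK -xw itin_coord0.
    rewrite /k; apply: (@leq_trans (l.+2 * n)); last by rewrite leq_mul2r lb orbT.
    by rewrite [leqRHS]mulSn leq_add2l leq_subr.
  apply: (@le_trans _ _ (fine (mu W))).
    apply: fine_le; rewrite ?fin_num_measure//; [exact: mphi (mk w)|].
    by apply: le_measure; rewrite ?inE//; exact: mphi (mk w).
  rewrite (uniform_blocks E hmu n0) big_ord_recl /= cardsT.
  have T0 : 0 < #|{: n.-tuple sym}|%:R :> R.
    by rewrite ltr0n; apply/card_gt0P; exists [tuple ord0 | _ < n].
  rewrite divff ?gt_eqF// mul1r -[X in _ ^+ X]card_ord -prodr_const.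
  apply: ler_prod => l _; rewrite divr_ge0//= ler_pdivrMr//.
  rewrite mulrAC ler_pdivlMr// -!natrM ler_nat; exact: gbal.
Qed.

End block_law.

(** * Bounds on the growth rate of the partition sum *)

Section pressure_bounds.
Context {R : realType} {d : nat} (A : Omega R d -> R) (F : R -> R).
Hypothesis hA : holder A.
Hypothesis hF : @convex_function R R^o [set: R] F.
Local Notation Omega := (Omega R d).
Local Notation prob := (probability Omega R).
Local Notation sym := 'I_d.+1.

(** The discretized integral, without the normalization (d+1)^-n of the
    uniform measure; each cylinder is represented by one of its points. *)
Definition partition_sum n : R :=
  \sum_(u : n.-tuple sym) expR (n%:R * F (birkhoff_avg A n (pad u))).

Lemma partition_sum_gt0 n : 0 < partition_sum n.
Proof.
rewrite /partition_sum (bigD1 [tuple ord0 | _ < n])//= ltr_pwDl ?expR_gt0//.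
by apply: sumr_ge0 => *; exact: expR_ge0.
Qed.

Let uA : unif_cont A := holder_unif_cont hA.

(** With N = n + m, the inequality between entropy and pressure reads
    H_n(xi) + E[N F(A_N)] <= ln Z_N + (small) N. The supporting line of F at the
    mean gives E[F(A_N)] >= F(mean) - |s| C / N, and H_n(xi) >= n h since the
    entropy rate is an infimum. *)
Lemma pressure_lower (rho : prob) k (xi : Omega -> 'I_k) e :
  invariant_prob rho -> finite_partition xi -> 0 < e ->
  \forall n \near \oo,
    F (mean rho A) + partition_entropy rho xi - e <= n%:R^-1 * ln (partition_sum n).
Proof.
move=> inv mxi e0; set a := mean rho A; set h := partition_entropy rho xi.
have [s hs] := convex_support hF a.
have [C C0 hC] := bounded_distortion hA.
have e40 : 0 < e / 4 by rewrite divr_gt0.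
(* t is chosen first, making the price k exp (- t) of the mismatch factor
   small; delta = e / (4 t) then makes the expected number of mismatches
   cheap. *)
have [t t0 ht] : exists2 t, 0 < t & k%:R * expR (- t) <= e / 4.
  have := @cvgr_expR R => /cvgrPdist_le.
  have k1 : 0 < k%:R + 1 :> R by rewrite ltr_wpDl.
  move=> /(_ _ (divr_gt0 e40 k1))[t0 [_ h']].
  exists (Num.max 1 (t0 + 1)); first by rewrite lt_max ltr01.
  have := h' (Num.max 1 (t0 + 1)); rewrite lt_max ltrDl ltr01 orbT => /(_ isT).
  rewrite sub0r normrN ger0_norm ?expR_ge0// ler_pdivlMr//.
  by have := expR_ge0 (- Num.max 1 (t0 + 1)); lra.
have [m [psi hpsi]] := partition_approx rho mxi (divr_gt0 e40 t0).
have [_ hH] := partition_entropy_lim inv mxi.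
near=> N.
have mN : (m < N)%N by near: N; exact: nbhs_infty_gt.
have N0 : (0 < N)%N by apply: leq_ltn_trans mN.
have N0' : 0 < N%:R :> R by rewrite ltr0n.
have hN : m%:R * `|h| + `|s| * C <= N%:R * (e / 4).
  by rewrite -ler_pdivrMr//; near: N; exact: nbhs_infty_ger.
rewrite -ler_pdivrMl ?invr_gt0// invrK.
pose n := (N - m)%N; have nmN : (n + m)%N = N by rewrite subnK// ltnW.
have := @entropy_pressure_ineq R d rho _ xi m psi (e / 4 / t) t n
  (fun u => (n + m)%:R * F (birkhoff_avg A (n + m) (pad u))) inv mxi (ltW t0) hpsi.
rewrite -/(partition_sum (n + m)) -join_entropyE card_ord nmN => main.
have lnle : ln (1 + k%:R * expR (- t)) <= e / 4.
  apply: le_trans ht; apply: le_ln1Dx.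
  by apply: (@lt_le_trans _ _ 0); rewrite ?oppr_lt0// mulr_ge0// expR_ge0.
have cost : n%:R * (ln (1 + k%:R * expR (- t)) + t * (e / 4 / t)) <= N%:R * (e / 2).
  apply: (@le_trans _ _ (n%:R * (e / 2))).
    by rewrite ler_wpM2l// [t * _]mulrC divfK ?gt_eqF//; move: lnle; lra.
  by rewrite ler_wpM2r ?ler_nat ?leq_subr// divr_ge0// ltW.
have energy : N%:R * F a - `|s| * C <=
    \sum_(u : N.-tuple sym) N%:R * F (birkhoff_avg A N (pad u)) * pr rho (word N) u.
  pose b := \int[rho]_x birkhoff_avg A N (pad (word N x)).
  have ba : `|b - a| <= N%:R^-1 * C.
    rewrite /b /a -(mean_birkhoff N0 inv uA); apply: Rintegral_close.
    - by apply: unif_cont_integrable; exact: (@unif_cont_word _ _ N (birkhoff_avg A N)).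
    - by apply: unif_cont_integrable; exact: unif_cont_birkhoff.
    - by move=> x; apply: hC; exact: pad_agree.
  apply: (@le_trans _ _ (N%:R * (F a + s * (b - a)))).
    rewrite mulrDr lerD2l lerNl -mulrN -mulrN.
    apply: (@le_trans _ _ (N%:R * (`|s| * (N%:R^-1 * C)))).
      rewrite ler_wpM2l//; apply: le_trans (ler_norm _) _.
      by rewrite normrM normrN ler_wpM2l.
    by rewrite mulrCA mulVKf// gt_eqF.
  rewrite /b Rintegral_word.
  under [leRHS]eq_bigr do rewrite -mulrA; rewrite -mulr_sumr ler_wpM2l//.
  set p := pr rho _; have p1 : \sum_u p u = 1 by apply: sum_pr; exact: observable_word.
  have -> : F a + s * (\sum_u birkhoff_avg A N (pad u) * p u - a) =
      \sum_u (F a + s * (birkhoff_avg A N (pad u) - a)) * p u.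
    transitivity ((F a - s * a) * \sum_u p u
        + s * \sum_u birkhoff_avg A N (pad u) * p u).
      by rewrite p1; ring.
    by rewrite !mulr_sumr -big_split; apply: eq_bigr => u _ /=; ring.
  by apply: ler_sum => u _; rewrite ler_wpM2r ?pr_ge0.
have entr : N%:R * h - m%:R * `|h| <= join_entropy rho xi n.
  apply: le_trans (hH n); rewrite natrB ?(ltnW mN)// -/h mulrBl lerD2l lerN2.
  by rewrite ler_wpM2l// ler_norm.
have : join_entropy rho xi n + (N%:R * F a - `|s| * C) <=
  ln (partition_sum N) + N%:R * (e / 2).
  apply: (le_trans _ (le_trans main _)); last by rewrite lerD2l.
  by rewrite lerD2l.
rewrite mulrBr mulrDr; move: entr hN.
have : N%:R * (e / 2) + N%:R * (e / 4) <= N%:R * e.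
  by rewrite -mulrDr ler_wpM2l//; lra.
move: (join_entropy _ _ _) (ln _) (`|s| * C) (N%:R * F a) (N%:R * h) (_ * `|h|)
  (N%:R * e) (_ * (e / 2)) (_ * (e / 4)) => *; lra.
Unshelve. all: by end_near. Qed.

Let bound : exists M K : R, [/\ 0 <= M, 0 <= K, forall x, `|A x| <= M &
  forall a b, `|a| <= M -> `|b| <= M -> `|F a - F b| <= K * `|a - b|].
Proof.
have [M M0 AM] := unif_cont_bounded uA.
by have [K K0 FK] := convex_lipschitz hF M; exists M, K.
Qed.

(** There are (d+1)^n words, and F is bounded on the range of the Birkhoff
    averages. *)
Lemma pressure_bounded : exists c, forall n, n%:R^-1 * ln (partition_sum n) <= c.
Proof.
have [M [K [M0 K0 AM FK]]] := bound.
exists (ln d.+1%:R + (`|F 0| + K * M)) => n.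
have c0 : 0 <= ln d.+1%:R + (`|F 0| + K * M).
  by rewrite !addr_ge0 ?mulr_ge0// ln_ge0// ler1n.
case: n => [|n]; first by rewrite invr0 mul0r.
rewrite ler_pdivrMl ?ltr0n//.
have : partition_sum n.+1 <= (d.+1%:R * expR (`|F 0| + K * M)) ^+ n.+1.
  rewrite exprMn -natrX -[in X in _ <= X * _](card_ord d.+1) -card_tuple.
  rewrite mulr_natl -sumr_const; apply: ler_sum => u _.
  rewrite -expRM_natl ler_expR ler_wpM2l//.
  have aM := birkhoff_bounded n.+1 (pad u) M0 AM.
  have := FK _ 0 aM; rewrite normr0 subr0 => /(_ M0).
  set a := birkhoff_avg A _ _ in aM *.
  have : K * `|a| <= K * M by rewrite ler_wpM2l.
  have := ler_normD (F a - F 0) (F 0); rewrite subrK.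
  by have := ler_norm (F a); move: (K * _) (K * _) => *; lra.
move=> Zle; have := partition_sum_gt0 n.+1 => Z0.
have De0 : 0 < d.+1%:R * expR (`|F 0| + K * M) by rewrite mulr_gt0 ?expR_gt0.
rewrite [leRHS]mulr_natl -[X in (_ + X) *+ _]expRK -lnM ?posrE ?expR_gt0//.
by rewrite -lnXn// ler_ln ?posrE ?exprn_gt0.
Qed.

(** Sort the words by the integer part of (A_n(u) + M) / eta, which takes
    values in a range independent of n, and keep the heaviest class. *)
Lemma heavy_bin n M eta : 0 <= M -> 0 < eta -> (forall x, `|A x| <= M) ->
  exists (S : {set n.-tuple sym}) (u0 : n.-tuple sym), [/\ u0 \in S,
    forall u, u \in S ->
      `|birkhoff_avg A n (pad u) - birkhoff_avg A n (pad u0)| <= eta &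
    partition_sum n <= (Num.truncn (2 * M / eta)).+1%:R *
      \sum_(u in S) expR (n%:R * F (birkhoff_avg A n (pad u)))].
Proof.
move=> M0 eta0 AM; set B := Num.truncn _.
pose a (u : n.-tuple sym) := birkhoff_avg A n (pad u).
pose w u := expR (n%:R * F (a u)).
have aM u : 0 <= (a u + M) / eta <= 2 * M / eta.
  have := birkhoff_bounded n (pad u) M0 AM; rewrite -/(a u) ler_norml => /andP[h1 h2].
  by rewrite divr_ge0 ?(ltW eta0)//=; [rewrite ler_pM2r ?invr_gt0//; lra|lra].
pose bin u : 'I_B.+1 := inord (Num.truncn ((a u + M) / eta)).
have binE u : bin u = Num.truncn ((a u + M) / eta) :> nat.
  by rewrite inordK// ltnS le_truncn//; case/andP: (aM u).
pose Z b := \sum_(u | bin u == b) w u.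
have ZE : partition_sum n = \sum_b Z b.
  by rewrite /partition_sum (partition_big bin xpredT).
pose b := [arg max_(i > ord0) Z i]%O.
have Zmax b' : Z b' <= Z b.
  by rewrite /b; case: (@arg_maxP _ _ _ (ord0 : 'I_B.+1) xpredT Z) => //= i _ h; exact: h.
have Zle : partition_sum n <= B.+1%:R * Z b.
  rewrite ZE; apply: (@le_trans _ _ (\sum_(i < B.+1) Z b)); first exact: ler_sum.
  by rewrite sumr_const card_ord mulr_natl.
pose S := [set u | bin u == b]%SET.
have ZS : Z b = \sum_(u in S) w u by apply: eq_bigl => u; rewrite inE.
have [u0 u0S] : exists u0, u0 \in S.
  apply/set0Pn/eqP => S0; move: Zle; rewrite ZS S0 big_set0 mulr0.
  by rewrite leNgt partition_sum_gt0.
exists S, u0; split => //; last by rewrite -ZS.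
move=> u uS; rewrite -/(a u) -/(a u0).
have : Num.truncn ((a u + M) / eta) = Num.truncn ((a u0 + M) / eta).
  by move: uS u0S; rewrite !inE -!binE => /eqP -> /eqP ->.
have /andP[u1 _] := aM u; have /andP[u2 _] := aM u0 => E.
have /andP[] := truncn_itv u1; have /andP[] := truncn_itv u2; rewrite E.
rewrite !ler_pdivlMr// !ltr_pdivrMr// -natr1 => *.
by rewrite ler_norml; apply/andP; split; lra.
Qed.

(** On the heaviest bin F(A_n) is nearly constant, so Z_n is at most a constant
    times |S| exp (n (F(a) + small)); the measure built from [S] has mean near
    a and entropy at least (ln |S| - ln 2) / n. *)
Lemma pressure_upper (mu : prob) e : uniform_product mu -> 0 < e ->
  \forall n \near \oo, exists2 rho : prob, invariant_prob rho &
    n%:R^-1 * ln (partition_sum n) <=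
    F (mean rho A) + partition_entropy rho coord0 + e.
Proof.
move=> hmu e0; have [M [K [M0 K0 AM FK]]] := bound.
have [C C0 hC] := bounded_distortion hA.
have K1 : 0 < K + 1 by rewrite ltr_wpDl.
pose eta := e / 4 / (K + 1); have eta0 : 0 < eta by rewrite !divr_gt0.
have Keta : K * eta <= e / 4.
  by rewrite /eta mulrA ler_pdivrMr// mulrC ler_wpM2l ?lerDl// divr_ge0// ltW.
pose B := Num.truncn (2 * M / eta).
have e20 : 0 < e / 2 by rewrite divr_gt0.
near=> n.
have n0 : (0 < n)%N by near: n; exists 1%N.
have n0' : 0 < n%:R :> R by rewrite ltr0n.
have hn : ln B.+1%:R + ln 2 + K * C <= n%:R * (e / 2).
  by rewrite -ler_pdivrMr//; near: n; exact: nbhs_infty_ger.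
have [S [u0 [u0S Seta SZ]]] := @heavy_bin n M eta M0 eta0 AM.
have S0 : (0 < #|S|)%N by apply/card_gt0P; exists u0.
have S0' : 0 < #|S|%:R :> R by rewrite ltr0n.
have [rho [inv rhoA rhoh]] := block_law hmu n0 S0; exists rho => //.
pose a u := birkhoff_avg A n (@pad R d n u).
have aM u : `|a u| <= M := birkhoff_bounded n (pad u) M0 AM.
have mA : `|mean rho A - a u0| <= eta + n%:R^-1 * C.
  apply: rhoA => // x xS; have := Seta _ xS.
  have := hC _ _ _ (agree_sym (@pad_agree _ _ n x)); rewrite -/(a _) -/(a u0).
  have := ler_normD (birkhoff_avg A n x - a (word n x)) (a (word n x) - a u0).
  rewrite addrA subrK; move: (_^-1 * C) `|_ - _| `|_ - _| `|_ - _| => *; lra.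
have Fa : F (a u0) <= F (mean rho A) + e / 4 + n%:R^-1 * (K * C).
  have := FK _ _ (mean_bounded rho uA AM) (aM u0); rewrite ler_distl => /andP[h _].
  apply: (@le_trans _ _ (F (mean rho A) + K * `|mean rho A - a u0|)).
    by rewrite -lerBlDr.
  rewrite -addrA lerD2l; apply: (@le_trans _ _ (K * (eta + n%:R^-1 * C))).
    by rewrite ler_wpM2l.
  by rewrite mulrDr [K * (_ * C)]mulrCA lerD2r.
have Zle : partition_sum n <= B.+1%:R * (#|S|%:R * expR (n%:R * (F (a u0) + e / 4))).
  apply: (le_trans SZ); rewrite ler_wpM2l// mulr_natl -sumr_const.
  apply: ler_sum => u uS; rewrite ler_expR ler_wpM2l// -/(a u).
  have := FK _ _ (aM u) (aM u0); rewrite ler_distl => /andP[_ h]; apply: (le_trans h).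
  rewrite lerD2l; apply: le_trans Keta; rewrite ler_wpM2l//; exact: Seta.
have : ln (partition_sum n) <= ln B.+1%:R + ln #|S|%:R + n%:R * (F (a u0) + e / 4).
  rewrite -addrA -[X in _ + (_ + X)]expRK -!lnM ?posrE ?mulr_gt0 ?expR_gt0//.
  by rewrite ler_ln ?posrE ?partition_sum_gt0// !mulr_gt0// expR_gt0.
have : n%:R * (n%:R^-1 * (ln #|S|%:R - ln 2)) <= n%:R * partition_entropy rho coord0.
  by rewrite ler_wpM2l.
have : n%:R * F (a u0) <= n%:R * (F (mean rho A) + e / 4 + n%:R^-1 * (K * C)).
  by rewrite ler_wpM2l.
rewrite ler_pdivrMl// !mulrDr !mulVKf ?gt_eqF//.
move: hn; have -> : n%:R * (e / 2) = n%:R * (e / 4) + n%:R * (e / 4).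
  by rewrite -mulrDr; congr (_ * _); lra.
have -> : n%:R * e = n%:R * (e / 4) + n%:R * (e / 4) + (n%:R * (e / 4) + n%:R * (e / 4)).
  by rewrite -!mulrDr; congr (_ * _); lra.
move: (K * C) (ln B.+1%:R) (ln 2) (ln #|S|%:R) (ln (partition_sum n)) (n%:R * (e / 4))
  (n%:R * F (a u0)) (n%:R * F (mean rho A)) (n%:R * partition_entropy _ _) => *; lra.
Unshelve. all: by end_near. Qed.

End pressure_bounds.

(** * The limit and its two variational formulas *)

Section limits.
Context {R : realType} {d : nat} (A : Omega R d -> R) (F : R -> R).
Hypothesis hA : holder A.
Hypothesis hF : @convex_function R R^o [set: R] F.
Local Notation Omega := (Omega R d).
Local Notation prob := (probability Omega R).
Local Notation sym := 'I_d.+1.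

(** On the cylinder of a word the exponent n F(A_n) varies by at most K C, where
    K is a Lipschitz constant of F and C bounds the distortion of the Birkhoff
    sums; each cylinder has mass (d+1)^-n. *)
Lemma log_laplace_partition_sum (mu : prob) : uniform_product mu ->
  exists C, forall n, (0 < n)%N ->
    `|log_laplace mu A F n - (n%:R^-1 * ln (partition_sum A F n) - ln d.+1%:R)|
    <= n%:R^-1 * C.
Proof.
move=> hmu; have uA := holder_unif_cont hA.
have [M M0 AM] := unif_cont_bounded uA; have [K K0 FK] := convex_lipschitz hF M.
have [C C0 hC] := bounded_distortion hA.
exists (K * C) => n n0; have n0' : 0 < n%:R :> R by rewrite ltr0n.
pose f x := n%:R * F (birkhoff_avg A n x).
pose I := \int[mu]_x expR (f x).
pose Z := d.+1%:R^-1 ^+ n * partition_sum A F n.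
have uf : unif_cont f.
  apply: unif_contZ; apply: (@unif_cont_lipschitz _ _ (birkhoff_avg A n) F M K) => //.
    exact: unif_cont_birkhoff.
  by move=> x; exact: birkhoff_bounded.
have [N N0 fN] := unif_cont_bounded uf.
have If : mu.-integrable setT (EFin \o (fun x => expR (f x))).
  apply: (@bounded_integrable _ _ _ _ (expR N)).
    exact: (measurableT_comp (@measurable_expR R) (unif_cont_measurable uf)).
  move=> x; rewrite ger0_norm ?expR_ge0// ler_expR.
  by apply: le_trans (ler_norm _) (fN x).
have Iw k : mu.-integrable setT (EFin \o (fun x => expR k * expR (f (pad (word n x))))).
  by apply: unif_cont_integrable; apply: unif_contZ;
    exact: (@unif_cont_word _ _ n (fun x => expR (f x))).
have dist x : `|f x - f (pad (word n x))| <= K * C.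
  rewrite /f -mulrBr normrM ger0_norm//.
  apply: (@le_trans _ _ (n%:R * (K * (n%:R^-1 * C)))).
    rewrite ler_wpM2l//; apply: le_trans (FK _ _ _ _) _; try exact: birkhoff_bounded.
    by rewrite ler_wpM2l//; exact: hC (agree_sym (@pad_agree _ _ n x)).
  by rewrite mulrCA mulVKf ?gt_eqF.
have ZE k : \int[mu]_x (expR k * expR (f (pad (word n x)))) = expR k * Z.
  rewrite (@Rintegral_word _ _ mu n (fun x => expR k * expR (f x))).
  rewrite /Z /partition_sum mulrCA !mulr_sumr; apply: eq_bigr => u _.
  by rewrite pr_uniform_word// -mulrA mulrCA [_ * _ ^+ n]mulrC mulrCA.
have Zle : expR (- (K * C)) * Z <= I.
  rewrite -ZE; apply: le_Rintegral => // x _; rewrite -expRD ler_expR.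
  by have := dist x; rewrite ler_distl => /andP[]; lra.
have Zge : I <= expR (K * C) * Z.
  rewrite -ZE; apply: le_Rintegral => // x _; rewrite -expRD ler_expR.
  by have := dist x; rewrite ler_distl => /andP[]; lra.
have D0 : 0 < d.+1%:R^-1 ^+ n :> R by rewrite exprn_gt0// invr_gt0 ltr0n.
have P0 := partition_sum_gt0 A F n.
have Z0 : 0 < Z by rewrite mulr_gt0.
have I0 : 0 < I by apply: lt_le_trans Zle; rewrite mulr_gt0// expR_gt0.
have lnZ : ln Z = ln (partition_sum A F n) - n%:R * ln d.+1%:R.
  rewrite /Z lnM ?posrE// lnXn ?invr_gt0 ?ltr0n// lnV ?posrE ?ltr0n//.
  by rewrite mulNrn addrC mulr_natl.
rewrite /log_laplace -/I -[X in _ - (_ - X)](mulKf (lt0r_neq0 n0')) -mulrBr -lnZ.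
rewrite -mulrBr normrM gtr0_norm ?invr_gt0// ler_wpM2l ?invr_ge0//.
rewrite ler_norml; apply/andP; split.
  rewrite lerBrDr -[X in X + _]expRK -lnM ?posrE ?expR_gt0//.
  by rewrite ler_ln ?posrE ?mulr_gt0 ?expR_gt0.
rewrite lerBlDr -[X in X + _]expRK -lnM ?posrE ?expR_gt0//.
by rewrite ler_ln ?posrE ?mulr_gt0 ?expR_gt0.
Qed.

(** The two bounds squeeze (ln Z_n) / n onto the supremum, whose finiteness
    comes from the boundedness of that sequence and from the existence of one
    invariant measure. *)
Lemma variational_limit (mu : prob) : uniform_product mu -> exists v : R,
  (fun n => n%:R^-1 * ln (partition_sum A F n)) @ \oo --> v /\
  ereal_sup [set ((F (mean rho A))%:E + KS_entropy rho)%E | rho in invariant_prob]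
    = v%:E.
Proof.
move=> hmu; pose z n := n%:R^-1 * ln (partition_sum A F n); set V := ereal_sup _.
have lower (rho : prob) k (xi : Omega -> 'I_k) e : invariant_prob rho ->
    finite_partition xi -> 0 < e ->
    \forall n \near \oo, F (mean rho A) + partition_entropy rho xi - e <= z n.
  by move=> inv mxi e0; exact: (pressure_lower hA hF inv mxi e0).
have leKS (rho : prob) k (xi : Omega -> 'I_k) : finite_partition xi ->
    ((partition_entropy rho xi)%:E <= KS_entropy rho)%E.
  by move=> mxi; apply: ereal_sup_ubound; exists k, xi.
have leV (rho : prob) k (xi : Omega -> 'I_k) : invariant_prob rho ->
    finite_partition xi -> ((F (mean rho A) + partition_entropy rho xi)%:E <= V)%E.
  move=> inv mxi; apply: (@le_trans _ _ ((F (mean rho A))%:E + KS_entropy rho)%E).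
    by rewrite EFinD leeD2l// leKS.
  by apply: ereal_sup_ubound; exists rho.
have [c hc] := pressure_bounded hA hF.
have Vc : (V <= (c + 1)%:E)%E.
  apply: ge_ereal_sup => _ [rho inv <-].
  rewrite -leeBrDl//; apply: ge_ereal_sup => _ [k [xi [mxi ->]]].
  rewrite leeBrDl// -EFinD lee_fin.
  have [n _ /(_ n (leqnn n))] := lower rho k xi 1 inv mxi ltr01.
  by have := hc n; rewrite -/(z n); lra.
have [v Vv] : exists v, V = v%:E.
  have [n _ /(_ n (leqnn n))] := pressure_upper hA hF hmu ltr01.
  move=> [rho inv _]; have := leV rho _ _ inv coord0_partition.
  by case: V Vc {leV} => // v _ _; exists v.
exists v; split => //; apply/cvgrPdist_le => e e0.
have e20 : 0 < e / 2 by rewrite divr_gt0.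
have : (V - (e / 2)%:E < V)%E by rewrite Vv -EFinB lte_fin ltrBlDr ltrDl.
move=> /ereal_sup_gt[_ [rho inv <-]]; rewrite Vv -EFinB => hrho.
have [k [xi [mxi hxi]]] : exists k (xi : Omega -> 'I_k),
    finite_partition xi /\ v - e / 2 < F (mean rho A) + partition_entropy rho xi.
  move: hrho; rewrite -lteBlDl// -EFinB.
  move=> /ereal_sup_gt[_ [k [xi [mxi ->]]]]; rewrite lte_fin => h.
  by exists k, xi; split=> //; move: h; lra.
near=> n; rewrite -[_ * _]/(z n) ler_distl; apply/andP; split.
  have [rho' inv' h] : exists2 rho' : prob, invariant_prob rho' &
      z n <= F (mean rho' A) + partition_entropy rho' coord0 + e.
    by near: n; exact: pressure_upper.
  have := leV rho' _ _ inv' coord0_partition; rewrite Vv lee_fin => h'.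
  by move: h h'; lra.
have : F (mean rho A) + partition_entropy rho xi - e / 2 <= z n.
  by near: n; exact: lower.
by move: hxi; lra.
Unshelve. all: by end_near. Qed.

(** One inequality is s a - F^*(s) <= F(a), valid for all s and a; for the
    other, at a = rho(A) the slope s of a supporting line gives equality. *)
Lemma legendre_variational (v c : R) :
  ereal_sup [set ((F (mean rho A))%:E + KS_entropy rho)%E
    | rho in (invariant_prob : set prob)] = v%:E ->
  ereal_sup [set (- legendre_fenchel F s + pressure (fun x => (s * A x)%R) - c%:E)%E
    | s in [set: R]] = (v - c)%:E.
Proof.
move=> Vv; have uA := holder_unif_cont hA.
have leV (rho : prob) : invariant_prob rho ->
    ((F (mean rho A))%:E + KS_entropy rho <= v%:E)%E.
  by move=> inv; rewrite -Vv; apply: ereal_sup_ubound; exists rho.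
apply/eqP; rewrite eq_le; apply/andP; split.
  apply: ge_ereal_sup => _ [s _ <-].
  have lF x : ((s * x - F x)%:E <= legendre_fenchel F s)%E.
    by apply: ereal_sup_ubound; exists x.
  have : ((s * 0 - F 0)%:E <= legendre_fenchel F s)%E by [].
  case E : (legendre_fenchel F s) => [r| |] // _; last by rewrite /= !addNye leNye.
  have : (pressure (fun x => s * A x)%R <= (v + r)%:E)%E.
    apply: ge_ereal_sup => _ [rho inv <-]; rewrite mean_scale//.
    have := leV rho inv; have := lF (mean rho A); rewrite E.
    case: (KS_entropy rho) => [h| |].
    - by rewrite -!EFinD !lee_fin; lra.
    - by rewrite !addey.
    - by move=> _ _; rewrite addeNy leNye.
  case: (pressure (fun x => s * A x)%R) => [p| |] //; last first.
    by move=> _; rewrite addeNy addNye leNye.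
  by rewrite lee_fin => h; rewrite -EFinN -!EFinD lee_fin; lra.
set S := ereal_sup _.
suff : (v%:E <= S + c%:E)%E by rewrite -leeBlDr// EFinB.
rewrite -Vv; apply: ge_ereal_sup => _ [rho inv <-].
rewrite -leeBlDr//; set a := mean rho A.
have [s hs] := convex_support hF a.
apply: (@le_trans _ _ (- legendre_fenchel F s + pressure (fun x => s * A x)%R - c%:E)%E);
  last by apply: ereal_sup_ubound; exists s.
apply: leeB => //.
have h1 : (legendre_fenchel F s <= (s * a - F a)%:E)%E.
  by apply: ge_ereal_sup => _ [x _ <-]; rewrite lee_fin; have := hs x; lra.
have h2 : ((s * a)%:E + KS_entropy rho <= pressure (fun x => s * A x)%R)%E.
  by apply: ereal_sup_ubound; exists rho => //; rewrite mean_scale.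
apply: (@le_trans _ _ ((- (s * a - F a))%:E + ((s * a)%:E + KS_entropy rho))%E).
  by rewrite addeA -EFinD; have -> : - (s * a - F a) + s * a = F a by lra.
by apply: leeD => //; rewrite EFinN leeN2.
Qed.

End limits.

Theorem mainTheorem4 (R : realType) (d : nat) (mu : probability (Omega R d) R)
    (A : Omega R d -> R) (F : R -> R) :
  uniform_product mu ->
  holder A ->
  @convex_function R R^o [set: R] F ->
  [/\ cvgn (log_laplace mu A F),
      (limn (log_laplace mu A F))%:E =
        ereal_sup [set (- legendre_fenchel F s + pressure (fun x => (s * A x)%R)
                        - (ln d.+1%:R)%:E)%E | s in [set: R]] &
      (limn (log_laplace mu A F))%:E =
        (ereal_sup [set ((F (mean rho A))%:E + KS_entropy rho)%E
                   | rho in invariant_prob] - (ln d.+1%:R)%:E)%E].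
Proof.
move=> hmu hA hF.
have [v [zv Vv]] := variational_limit hA hF hmu.
have [C hC] := log_laplace_partition_sum hA hF hmu.
have lim : log_laplace mu A F @ \oo --> v - ln d.+1%:R.
  have zv' : (fun n => n%:R^-1 * ln (partition_sum A F n) - ln d.+1%:R) @ \oo
      --> v - ln d.+1%:R by apply: cvgB => //; exact: cvg_cst.
  apply/cvgrPdist_le => e e0; have e20 : 0 < e / 2 by rewrite divr_gt0.
  move/cvgrPdist_le : zv' => /(_ _ e20) zv'.
  near=> n.
  have n0 : (0 < n)%N by near: n; exists 1%N.
  have n0' : 0 < n%:R :> R by rewrite ltr0n.
  have Cn : n%:R^-1 * C <= e / 2.
    rewrite ler_pdivrMl// -ler_pdivrMr//.
    by near: n; exact: nbhs_infty_ger.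
  have h1 : `|v - ln d.+1%:R - (n%:R^-1 * ln (partition_sum A F n) - ln d.+1%:R)| <= e / 2.
    by near: n.
  have := ler_normD (v - ln d.+1%:R - (n%:R^-1 * ln (partition_sum A F n) - ln d.+1%:R))
    (n%:R^-1 * ln (partition_sum A F n) - ln d.+1%:R - log_laplace mu A F n).
  rewrite addrA subrK => h2; have := hC n n0; rewrite distrC => h3.
  rewrite [e]splitr; apply: (le_trans h2); apply: lerD => //.
  exact: le_trans h3 Cn.
have limE : limn (log_laplace mu A F) = v - ln d.+1%:R by exact: cvg_lim.
split; first by apply/cvg_ex; exists (v - ln d.+1%:R).
  by rewrite limE (legendre_variational hA hF _ Vv).
by rewrite limE Vv EFinB.
Unshelve. all: by end_near. Qed.
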